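(* Let $M$ be a separable II$_1$ factor. Then $M$ has the Jung property if and only if $M$ has the weak Jung property and is self-tracially stable.
   Context: II$_1$ factors are equipped with their unique faithful normal tracial state $\tau$, and $\|x\|_2=\tau(x^*x)^{1/2}$. An embedding is a unital trace-preserving (hence injective) $*$-homomorphism; an endomorphism of $M$ is an embedding $M\to M$; $*$-homomorphisms are unital. For a nonprincipal ultrafilter $\mathcal U$ on $\mathbb N$, $M^{\mathcal U}$ denotes the tracial ultrapower, and the diagonal embedding $M\to M^{\mathcal U}$ sends $x$ to the class of the constant sequence $x$. $M$ has the Jung property if for every nonprincipal ultrafilter $\mathcal U$ on $\mathbb N$, every embedding $f:M\to M^{\mathcal U}$ is unitarily conjugate to the diagonal embedding, i.e. there is a unitary $u\in M^{\mathcal U}$ with $uf(x)u^*=x$ for all $x\in M$ (identifying $M$ with its diagonal image). $M$ has the weak Jung property if every endomorphism $f$ of $M$ is approximately inner: for every finite $F\subseteq M$ and $\epsilon>0$ there is a unitary $v\in M$ with $\|vf(x)v^*-x\|_2<\epsilon$ for all $x\in F$. $M$ is self-tracially stable if for every nonprincipal ultrafilter $\mathcal U$ on $\mathbb N$ and every embedding $f:M\to M^{\mathcal U}$ there are $*$-homomorphisms $f_i:M\to M$ ($i\in\mathbb N$) such that $f(x)=(f_i(x))_{\mathcal U}$ for all $x\in M$. *)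

(* Defs.v *)
From HB Require Import structures.
From mathcomp Require Import all_boot all_order all_algebra.
From mathcomp Require Import sesquilinear complex generic_quotient.
From mathcomp Require Import all_classical all_reals.
From mathcomp Require Import topology normedtype.
From mathcomp Require Import ring lra.

Set Implicit Arguments.
Unset Strict Implicit.
Unset Printing Implicit Defensive.

Import Order.TTheory GRing.Theory Num.Theory.
Import numFieldNormedType.Exports.

Local Open Scope classical_set_scope.
Local Open Scope quotient_scope.
Local Open Scope ring_scope.

HB.mixin Record isHilbert (R : realType) H of CompleteNormedModule R[i] H := {
  inner : {dot H for (@Num.conj R[i])};
  inner_norm : forall u : H, inner u u = `|u| ^+ 2
}.

#[short(type="hilbertType")]
HB.structure Definition Hilbert (R : realType) :=
  {H of isHilbert R H & CompleteNormedModule R[i] H}.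

HB.mixin Record isStarAlgebra (R : realType) A of GRing.Algebra R[i] A := {
  star : A -> A;
  starD : {morph star : x y / x + y};
  starZ : forall (a : R[i]) x, star (a *: x) = a^* *: star x;
  starM : forall x y, star (x * y) = star y * star x;
  starK : involutive star
}.

#[short(type="starAlgType")]
HB.structure Definition StarAlgebra (R : realType) :=
  {A of isStarAlgebra R A & GRing.Algebra R[i] A}.

HB.mixin Record isTracial (R : realType) A of StarAlgebra R A := {
  tr : A -> R[i];
  tr_scalar : scalar tr;
  tr1 : tr 1 = 1;
  tr_mulC : forall x y, tr (x * y) = tr (y * x);
  tr_ge0 : forall x, 0 <= tr (star x * x);
  tr_faithful : forall x, tr (star x * x) = 0 -> x = 0
}.

#[short(type="tracialAlgType")]
HB.structure Definition TracialAlgebra (R : realType) :=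
  {A of isTracial R A & StarAlgebra R A}.

Section Operators.
Context {R : realType} {H : hilbertType R}.

Definition bounded_operator (T : H -> H) := linear T /\ continuous T.

Definition commutant (S : set (H -> H)) : set (H -> H) :=
  [set T | bounded_operator T /\ forall A, S A -> T \o A = A \o T].

Definition positive_operator (T : H -> H) := forall v, 0 <= inner (T v) v.

End Operators.

(* A von Neumann algebra M of operators on H; elements of M act on H through
   [act], which identifies M with a *-subalgebra of B(H) equal to its double
   commutant. *)
HB.mixin Record isVonNeumann (R : realType) (H : hilbertType R) M
    of StarAlgebra R M := {
  act : M -> H -> H;
  act_inj : injective act;
  actD : forall x y v, act (x + y) v = act x v + act y v;
  actZ : forall a x v, act (a *: x) v = a *: act x v;
  actM : forall x y v, act (x * y) v = act x (act y v);
  act1 : forall v, act 1 v = v;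
  act_star : forall x u v, inner (act (star x) u) v = inner u (act x v);
  act_bicommutant : commutant (commutant (range act)) = range act
}.

#[short(type="vonNeumannType")]
HB.structure Definition VonNeumann (R : realType) (H : hilbertType R) :=
  {M of isVonNeumann R H M & StarAlgebra R M}.

Section VonNeumannOrder.
Context {R : realType} {H : hilbertType R} {M : vonNeumannType H}.

Definition positive (x : M) := positive_operator (act x).

Definition op_le (x y : M) := positive (y - x).

Definition directed (D : set M) := D !=set0 /\
  forall x y, D x -> D y -> exists2 z, D z & op_le x z /\ op_le y z.

Definition op_lub (D : set M) (s : M) := (forall x, D x -> op_le x s) /\
  forall t, (forall x, D x -> op_le x t) -> op_le s t.

Definition normal (phi : M -> R[i]) :=
  forall (D : set M) (s : M), directed D -> (forall x, D x -> positive x) ->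
    op_lub D s ->
    complex.Re (phi s) = sup [set complex.Re (phi x) | x in D].

Definition factor :=
  forall x : M, (forall y : M, x * y = y * x) -> exists a : R[i], x = a%:A.

Definition infinite_dimensional :=
  ~ exists (n : nat) (e : 'I_n -> M),
      forall x : M, exists c : 'I_n -> R[i], x = \sum_(i < n) c i *: e i.

End VonNeumannOrder.
Arguments factor {R H} M.
Arguments infinite_dimensional {R H} M.

(* Positivity of the trace on all positive operators of M subsumes [tr_ge0]. *)
HB.mixin Record isNormalTrace (R : realType) (H : hilbertType R) M
    of VonNeumann R H M & TracialAlgebra R M := {
  tr_positive : forall x : M, positive x -> 0 <= tr x;
  tr_normal : normal (tr : M -> R[i])
}.

#[short(type="tracialVonNeumannType")]
HB.structure Definition TracialVonNeumann (R : realType) (H : hilbertType R) :=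
  {M of isNormalTrace R H M & VonNeumann R H M & TracialAlgebra R M}.

HB.mixin Record isII1Factor (R : realType) (H : hilbertType R) M
    of TracialVonNeumann R H M := {
  II1_factor : factor M;
  II1_infinite_dimensional : infinite_dimensional M
}.

#[short(type="II1FactorType")]
HB.structure Definition II1Factor (R : realType) (H : hilbertType R) :=
  {M of isII1Factor R H M & TracialVonNeumann R H M}.

Section TracialTheory.
Context {R : realType} {A : tracialAlgType R}.
Implicit Types x y z : A.

Lemma star0 : star (0 : A) = 0.
Proof. by rewrite -[0 in LHS](scale0r (0 : A)) starZ conjC0 scale0r. Qed.

Lemma starN x : star (- x) = - star x.
Proof. by rewrite -scaleN1r starZ rmorphN rmorph1 scaleN1r. Qed.

Lemma starB x y : star (x - y) = star x - star y.
Proof. by rewrite starD starN. Qed.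

Lemma star1 : star (1 : A) = 1.
Proof. by rewrite -[LHS]mul1r -{1}[1]starK -starM mul1r starK. Qed.

Lemma trD x y : tr (x + y) = tr x + tr y.
Proof. by rewrite -[x in LHS]scale1r tr_scalar mul1r. Qed.

Lemma tr0 : tr (0 : A) = 0.
Proof. by have/eqP := trD 0 0; rewrite addr0 -subr_eq subrr eq_sym => /eqP. Qed.

Lemma trZ a x : tr (a *: x) = a * tr x.
Proof. by rewrite -[a *: x]addr0 tr_scalar tr0 addr0. Qed.

Lemma trN x : tr (- x) = - tr x.
Proof. by rewrite -scaleN1r trZ mulN1r. Qed.

Lemma trB x y : tr (x - y) = tr x - tr y.
Proof. by rewrite trD trN. Qed.

Definition norm2 x : R := Num.sqrt (complex.Re (tr (star x * x))).

Lemma tr_starM x : tr (star x * x) = ((norm2 x ^+ 2)%:C)%C.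
Proof.
have := tr_ge0 x; rewrite lecE /= => /andP[/eqP im re].
by rewrite sqr_sqrtr //; apply/eqP; rewrite eq_complex /= im !eqxx.
Qed.

Lemma norm2_star x : norm2 (star x) = norm2 x.
Proof. by rewrite /norm2 starK tr_mulC. Qed.

Lemma norm2_ge0 x : 0 <= norm2 x. Proof. exact: sqrtr_ge0. Qed.

Lemma norm2N x : norm2 (- x) = norm2 x.
Proof. by rewrite /norm2 starN mulrNN. Qed.

Lemma norm2_sqrD x y :
  norm2 (x + y) ^+ 2 <= 2 * (norm2 x ^+ 2 + norm2 y ^+ 2).
Proof.
suff E : norm2 (x + y) ^+ 2 + norm2 (x - y) ^+ 2 =
    2 * (norm2 x ^+ 2 + norm2 y ^+ 2) by rewrite -E lerDl sqr_ge0.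
apply: complexI; rewrite rmorphM !rmorphD /= -!tr_starM.
rewrite -!trD starD starB !mulrDl !mulrDr !(mulrN, mulNr) opprK !trD !trN.
rewrite rmorph1; ring.
Qed.

Lemma tr_star x : tr (star x) = (tr x)^*.
Proof.
have real c : complex.Im (c * tr x + c^* * tr (star x)) = 0.
  have := tr_ge0 (1 + c *: x).
  rewrite starD star1 starZ mulrDl !mulrDr !mulr1 !mul1r !trD tr1.
  rewrite -scalerAl -scalerAr !trZ => /ger0_Im.
  have [/ger0_Im im1 /ger0_Im im2] := (tr_ge0 x, mulcJ_ge0 c).
  move: im1 im2; rewrite -/(c^*).
  case: (tr (star x * x)) => p q /= -> ; case: (c) => u v /=.
  case: (tr x) => e f; case: (tr (star x)) => g h /=.
  by move=> ??; lra.
have := real 1; have := real ('i)%C.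
case: (tr x) => e f; case: (tr (star x)) => g h /= h1 h2.
by apply/eqP; rewrite eq_complex /=; apply/andP; split; apply/eqP; lra.
Qed.

Lemma norm_tr_le x : `|tr x| <= ((norm2 x)%:C)%C.
Proof.
rewrite -(@ler_sqr R[i]) ?nnegrE ?normr_ge0 ?ler0c ?norm2_ge0 //.
rewrite -[leRHS]rmorphXn /= -tr_starM.
have := tr_ge0 (x - (tr x)%:A).
rewrite starB starZ star1 mulrBl !mulrBr !trB.
rewrite -!scalerAl -!scalerAr !mulr1 !mul1r !trZ tr1 mulr1 subrr subr0.
by rewrite tr_star subr_ge0 normCK.
Qed.
End TracialTheory.

Section BoundedSequences.
Context {R : realType} {H : hilbertType R} {M : tracialVonNeumannType H}.
Implicit Types x y : M.

Definition op_bounded (K : R) x :=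
  forall v : H, `|act x v| <= (K%:C)%C * `|v|.

Lemma op_boundedW K L x : K <= L -> op_bounded K x -> op_bounded L x.
Proof.
by move=> KL b v; apply: (le_trans (b v)); rewrite ler_wpM2r ?lecR.
Qed.

Lemma act0 (v : H) : act (0 : M) v = 0.
Proof. by rewrite -[0 in LHS](scale0r (0 : M)) actZ scale0r. Qed.

Lemma op_bounded0 : op_bounded 0 0.
Proof. by move=> v; rewrite act0 normr0 mul0r. Qed.

Lemma op_bounded1 : op_bounded 1 1.
Proof. by move=> v; rewrite act1 mul1r. Qed.

Lemma op_boundedD K L x y :
  op_bounded K x -> op_bounded L y -> op_bounded (K + L) (x + y).
Proof.
move=> bx b v; rewrite actD rmorphD mulrDl.
exact: le_trans (ler_normD _ _) (lerD (bx v) (b v)).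
Qed.

Lemma op_boundedZ K a x :
  op_bounded K x -> op_bounded (complex.Re `|a| * K) (a *: x).
Proof.
move=> bx v; have -> : ((complex.Re `|a| * K)%:C)%C = `|a| * (K%:C)%C.
  by rewrite rmorphM /=; congr (_ * _); rewrite RRe_real ?normr_real.
by rewrite actZ normrZ -mulrA ler_wpM2l.
Qed.

Lemma op_boundedM K L x y : 0 <= K ->
  op_bounded K x -> op_bounded L y -> op_bounded (K * L) (x * y).
Proof.
move=> K0 bx b v; rewrite actM rmorphM -mulrA.
by apply: (le_trans (bx _)); rewrite ler_wpM2l ?ler0c.
Qed.

Lemma op_bounded_star K x : 0 < K -> op_bounded K x -> op_bounded K (star x).
Proof.
move=> K0 bx v; set a := act (star x) v.
have K1 : 0 < (K%:C)%C by rewrite ltcE /= eqxx.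
have K2 : 0 < (K%:C)%C ^+ 2 by rewrite exprn_gt0.
rewrite -(@ler_pXn2r _ 2) ?nnegrE ?mulr_ge0 ?ler0c ?(ltW K0) //.
rewrite exprMn -(ler_pM2l K2) -!inner_norm.
have va : inner v (act x a) = inner a a by rewrite -act_star.
have := dnorm_ge0 inner ((K%:C)%C ^+ 2 *: v - act x a).
rewrite dnormB dnormZ linearZl_LR /= va.
rewrite (ger0_norm (ltW K2)) geC0_conj; last first.
  by rewrite mulr_ge0 ?dnorm_ge0 // ltW.
rewrite subr_ge0 => h; rewrite -(lerD2r ((K%:C)%C ^+ 2 * inner a a)).
apply: (le_trans h); rewrite mulrA -expr2 lerD2l !inner_norm -exprMn.
by rewrite ler_pXn2r ?nnegrE ?mulr_ge0 // ?ltW.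
Qed.

Lemma norm2M_le K x y : 0 <= K -> op_bounded K x ->
  norm2 (x * y) ^+ 2 <= K ^+ 2 * norm2 y ^+ 2.
Proof.
move=> K0 bx.
have : 0 <= tr ((K ^+ 2)%:C%C *: (star y * y) - star (x * y) * (x * y)).
  apply: tr_positive => v.
  have actB (z w : M) u : act (z - w) u = act z u - act w u.
    by rewrite actD -scaleN1r actZ scaleN1r.
  rewrite actB actZ linearBl /= linearZl_LR /= !(actM (star _)) !act_star.
  rewrite subr_ge0 !inner_norm rmorphXn -exprMn actM.
  by rewrite ler_pXn2r ?nnegrE ?mulr_ge0 ?ler0c.
by rewrite trB trZ !tr_starM subr_ge0 -rmorphM lecR.
Qed.

Lemma norm2_star_mul_le K x y : 0 < K -> op_bounded K y ->
  norm2 (x * y) ^+ 2 <= K ^+ 2 * norm2 x ^+ 2.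
Proof.
move=> K0 b; rewrite -norm2_star starM -(norm2_star x).
exact/norm2M_le/op_bounded_star/b/K0/ltW.
Qed.

Lemma norm2_bounded K x : 0 <= K -> op_bounded K x -> norm2 x <= K.
Proof.
move=> K0 b; rewrite -(@ler_pXn2r _ 2) ?nnegrE ?norm2_ge0 //.
have := norm2M_le 1 K0 b; rewrite mulr1 => /le_trans; apply.
by rewrite /norm2 star1 mul1r tr1 /= sqrtr1 expr1n mulr1.
Qed.

Lemma act_bounded_operator x : bounded_operator (act x).
Proof.
by have : range (act : M -> H -> H) (act x) by []; rewrite -act_bicommutant => -[].
Qed.

Lemma op_bounded_ex x : exists K : R, op_bounded K x.
Proof.
have [lin cont] := act_bounded_operator x.
pose f : {linear H -> H} := HB.pack (act x) (GRing.isLinear.Build _ _ _ _ _ lin).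
have /linear_bounded_continuous/linear_boundedP : continuous f by [].
move=> /pinfty_ex_gt0[r r0 b]; exists (complex.Re r) => v.
by rewrite RRe_real ?gtr0_real //; exact: b.
Qed.

End BoundedSequences.

Section FunctionAlgebra.
Context {R : pzRingType} {A : algType R} {T : pointedType}.

Let fct_scalerAl (a : R) (f g : T -> A) : a *: (f * g) = (a *: f) * g.
Proof. by apply/funext => t; exact: scalerAl. Qed.

HB.instance Definition _ :=
  GRing.Lmodule_isLalgebra.Build R (T -> A) fct_scalerAl.

Let fct_scalerAr (a : R) (f g : T -> A) : a *: (f * g) = f * (a *: g).
Proof. by apply/funext => t; exact: scalerAr. Qed.

HB.instance Definition _ :=
  GRing.Lalgebra_isAlgebra.Build R (T -> A) fct_scalerAr.
End FunctionAlgebra.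

Section Linf.
Context {R : realType} {H : hilbertType R}.
Variable M : tracialVonNeumannType H.

Definition bounded_seqs : {pred (nat -> M)} :=
  fun x => `[< exists K : R, forall n, op_bounded K (x n) >].

Lemma bounded_seqsP (x : nat -> M) :
  reflect (exists2 K : R, 0 < K & forall n, op_bounded K (x n))
    (x \in bounded_seqs).
Proof.
apply: (iffP (asboolP _)) => [[K b]|[K _ b]]; last by exists K.
exists (`|K| + 1) => [|n]; first by rewrite ltr_wpDl.
by apply: op_boundedW (b n); rewrite (le_trans (ler_norm K)) // lerDl.
Qed.

Fact bounded_seqs_subalg_closed : GRing.subalg_closed bounded_seqs.
Proof.
split => [|a x y /bounded_seqsP[K _ bx] /bounded_seqsP[L _ b]|
  x y /bounded_seqsP[K K0 bx] /bounded_seqsP[L _ b]].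
- by apply/asboolP; exists 1 => n; exact: op_bounded1.
- apply/asboolP; exists (complex.Re `|a| * K + L) => n.
  exact/op_boundedD/b/op_boundedZ/bx.
- by apply/asboolP; exists (K * L) => n; exact/op_boundedM/b/bx/ltW.
Qed.

HB.instance Definition _ := GRing.isSubalgClosed.Build R[i] (nat -> M)
  bounded_seqs bounded_seqs_subalg_closed.

(* l^oo(M), the algebra of operator-norm bounded sequences in M. *)
Record linf := Linf { linf_val :> nat -> M; _ : linf_val \in bounded_seqs }.

HB.instance Definition _ := [isSub for linf_val].
HB.instance Definition _ := [Choice of linf by <:].
HB.instance Definition _ := [SubChoice_isSubAlgebra of linf by <:].

Fact linf_star_subproof (x : linf) : (star \o x : nat -> M) \in bounded_seqs.
Proof.
case: x => x /= /bounded_seqsP[K K0 b]; apply/asboolP; exists K => n.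
exact/op_bounded_star/b.
Qed.

Definition linf_star (x : linf) : linf := Linf (linf_star_subproof x).

Fact linf_const_subproof (x : M) : ((fun=> x) : nat -> M) \in bounded_seqs.
Proof. by have [K b] := op_bounded_ex x; apply/asboolP; exists K. Qed.

Definition linf_const (x : M) : linf := Linf (linf_const_subproof x).

End Linf.

Record free_ultrafilter := FreeUltrafilter {
  ultra_sets :> set_system nat;
  ultra_isultra : UltraFilter ultra_sets;
  ultra_free : forall n, ~ ultra_sets [set n]
}.
#[global] Existing Instance ultra_isultra.

Lemma ultra_fmap (S T : Type) (f : S -> T) (F : set_system S) :
  UltraFilter F -> UltraFilter (fmap f F).
Proof.
move=> FU; split; first exact: fmap_proper_filter.
move=> G GF FG; apply/seteqP; split=> // A GA.
have [//|FA] := in_ultra_setVsetC (f @^-1` A) FU.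
by have /FG/(filterI GA) : fmap f F (~` A) by []; rewrite setICr => /filter_not_empty.
Qed.

Lemma normc_ge_Im (R : rcfType) (z : R[i]) : (`|complex.Im z|%:C)%C <= `|z|.
Proof.
rewrite normc_def lecR -sqrtr_sqr.
by rewrite ler_sqrt ?lerDr ?addr_ge0 ?sqr_ge0.
Qed.

Section UltraLimits.
Context {R : realType}.
Variable U : free_ultrafilter.
Implicit Types u w : nat -> R.

Lemma ultra_cvg u K : (forall n, `|u n| <= K) -> cvg (u n @[n --> ultra_sets U]).
Proof.
move=> b; have := @segment_compact R (- K) K; rewrite compact_ultra.
have UF : UltraFilter (u n @[n --> ultra_sets U]) by exact: ultra_fmap.
move=> /(_ _ UF)[|p [_ up]]; last by apply/cvg_ex; exists p.
have E : (u @^-1` `[- K, K]) = setT; last first.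
  by rewrite /fmap /= -/(u @^-1` `[- K, K]) E; exact: filterT.
by apply/seteqP; split => // n _; rewrite /= in_itv /= -ler_norml.
Qed.

Lemma ultra_cvg0_le u w : (forall n, 0 <= u n <= w n) ->
  w n @[n --> ultra_sets U] --> (0 : R) -> u n @[n --> ultra_sets U] --> (0 : R).
Proof.
move=> uw w0; apply: (@squeeze_cvgr _ _ _ _ (fun=> 0) w) => //; last exact: cvg_cst.
by apply: filterE.
Qed.

Lemma cvg0_sqr u : (u n @[n --> ultra_sets U] --> (0 : R)) <->
  (u n ^+ 2 @[n --> ultra_sets U] --> (0 : R)).
Proof.
split=> [u0|u0].
  by have := cvgM u0 u0; rewrite mulr0; apply.
apply/cvgr0Pnorm_lt => e e0.
have /cvgr0Pnorm_lt /(_ (e ^+ 2)) := u0; rewrite exprn_gt0 // => /(_ isT).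
by apply: filterS => n; rewrite normrX ltr_pXn2r ?nnegrE // ltW.
Qed.

(* Limits along U of complex sequences, taken on real and imaginary parts. *)
Definition climit (z : nat -> R[i]) : R[i] :=
  (lim (complex.Re (z n) @[n --> ultra_sets U]) +i* lim (complex.Im (z n) @[n --> ultra_sets U]))%C.

Definition cbounded (z : nat -> R[i]) := exists K : R, forall n, `|z n| <= (K%:C)%C.

Lemma cbounded_cvg z : cbounded z ->
  cvg (complex.Re (z n) @[n --> ultra_sets U]) /\ cvg (complex.Im (z n) @[n --> ultra_sets U]).
Proof.
move=> [K b]; split; apply: (@ultra_cvg _ K) => n; rewrite -lecR.
  exact: le_trans (normc_ge_Re _) (b n).
exact: le_trans (normc_ge_Im _) (b n).
Qed.

Lemma cbounded_scale a z : cbounded z -> cbounded (fun n => a * z n).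
Proof.
move=> [K b]; exists (complex.Re `|a| * K) => n.
have -> : ((complex.Re `|a| * K)%:C)%C = `|a| * (K%:C)%C.
  by rewrite rmorphM /=; congr (_ * _); rewrite RRe_real ?normr_real.
by rewrite normrM ler_wpM2l.
Qed.

Lemma climitD z t : cbounded z -> cbounded t ->
  climit (fun n => z n + t n) = climit z + climit t.
Proof.
move=> /cbounded_cvg[rz iz] /cbounded_cvg[rt it].
rewrite /climit; apply/eqP; rewrite eq_complex /= -!limD //.
have -> : (fun n => complex.Re (z n + t n)) =
    (fun n => complex.Re (z n) + complex.Re (t n)).
  by apply/funext => n; case: (z n) (t n) => ? ? [].
have -> : (fun n => complex.Im (z n + t n)) =
    (fun n => complex.Im (z n) + complex.Im (t n)).
  by apply/funext => n; case: (z n) (t n) => ? ? [].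
by rewrite !eqxx.
Qed.

Lemma climitZ a z : cbounded z -> climit (fun n => a * z n) = a * climit z.
Proof.
move=> /cbounded_cvg[rz iz]; case: a => a b.
have E (c : R) (u : nat -> R) : cvg (u n @[n --> ultra_sets U]) ->
    c * lim (u n @[n --> ultra_sets U]) = lim (c * u n @[n --> ultra_sets U]).
  by move=> cu; apply/esym/cvg_lim => //; exact: cvgMr.
have Z (c : R) (u : nat -> R) : cvg (u n @[n --> ultra_sets U]) ->
    cvg (c * u n @[n --> ultra_sets U]).
  by move=> /cvg_ex[l ul]; apply/cvg_ex; exists (c * l); exact: cvgMr.
rewrite /climit; apply/eqP; rewrite eq_complex /= !E // -limB -?limD; try exact: Z.
have -> : (fun n => complex.Re ((a +i* b)%C * z n)) =
    (fun n => a * complex.Re (z n) - b * complex.Im (z n)).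
  by apply/funext => n; case: (z n).
have -> : (fun n => complex.Im ((a +i* b)%C * z n)) =
    (fun n => a * complex.Im (z n) + b * complex.Re (z n)).
  by apply/funext => n; case: (z n).
by rewrite !eqxx.
Qed.

Lemma climit_cst c : climit (fun=> c) = c.
Proof. by case: c => a b; rewrite /climit /= !lim_cst. Qed.

Lemma climit0 z (u : nat -> R) : (forall n, `|z n| <= ((u n)%:C)%C) ->
  u n @[n --> ultra_sets U] --> (0 : R) -> climit z = 0.
Proof.
move=> zu u0; rewrite /climit.
have K (f : nat -> R) : (forall n, (`|f n|%:C)%C <= `|z n|) ->
    lim (f n @[n --> ultra_sets U]) = 0.
  move=> fz; apply: cvg_lim => //; apply/norm_cvg0P.
  apply: ultra_cvg0_le u0 => n; rewrite normr_ge0 /= -lecR.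
  exact: le_trans (fz n) (zu n).
by rewrite !K // => n; [exact: normc_ge_Im|exact: normc_ge_Re].
Qed.

End UltraLimits.

Section Ultrapower.
Context {R : realType} {H : hilbertType R}.
Variables (M : tracialVonNeumannType H) (U : free_ultrafilter).
Implicit Types x y z : linf M.

Definition null_seq x := norm2 (x n) @[n --> ultra_sets U] --> (0 : R).

Lemma null_seq_le x y (K : R) :
  (forall n, norm2 (x n) ^+ 2 <= K * norm2 (y n) ^+ 2) ->
  null_seq y -> null_seq x.
Proof.
move=> xy /cvg0_sqr y0; apply/cvg0_sqr.
apply: (@ultra_cvg0_le _ _ _ (fun n => K * norm2 (y n) ^+ 2)) => [n|].
  by rewrite sqr_ge0 xy.
suff : K * norm2 (y n) ^+ 2 @[n --> ultra_sets U] --> K * 0 by rewrite mulr0.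
exact: cvgMr.
Qed.

Lemma null_seq0 : null_seq 0.
Proof.
rewrite /null_seq /norm2 /=; under eq_fun do rewrite mulr0 tr0 sqrtr0.
exact: cvg_cst.
Qed.

Lemma null_seqN x : null_seq x -> null_seq (- x).
Proof.
apply: (@null_seq_le _ _ 1) => n; rewrite mul1r.
by rewrite [(- x : linf M) n]/= norm2N.
Qed.

Lemma null_seqD x y : null_seq x -> null_seq y -> null_seq (x + y).
Proof.
move=> /cvg0_sqr x0 /cvg0_sqr y0; apply/cvg0_sqr.
apply: (@ultra_cvg0_le _ _ _
  (fun n => 2 * (norm2 (x n) ^+ 2 + norm2 (y n) ^+ 2))) => [n|].
  by rewrite sqr_ge0 norm2_sqrD.
suff : 2 * (norm2 (x n) ^+ 2 + norm2 (y n) ^+ 2) @[n --> ultra_sets U]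
    --> 2 * (0 + 0 : R) by rewrite addr0 mulr0.
by apply: cvgMr; exact: cvgD.
Qed.

Lemma null_seqMl x y : null_seq y -> null_seq (x * y).
Proof.
case: x => x xb /=; have /bounded_seqsP[K K0 b] := xb.
by apply: (@null_seq_le _ _ (K ^+ 2)) => n; exact/norm2M_le/b/ltW.
Qed.

Lemma null_seqMr x y : null_seq x -> null_seq (x * y).
Proof.
case: y => y yb /=; have /bounded_seqsP[K K0 b] := yb.
by apply: (@null_seq_le _ _ (K ^+ 2)) => n; exact/norm2_star_mul_le/b.
Qed.

Lemma null_seq_star x : null_seq x -> null_seq (linf_star x).
Proof. by apply: (@null_seq_le _ _ 1) => n; rewrite mul1r norm2_star. Qed.

Lemma null_seqZ a x : null_seq x -> null_seq (a *: x).
Proof.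
have -> : a *: x = a%:A * x by rewrite -scalerAl mul1r.
exact: null_seqMl.
Qed.

Lemma null_seq1 : ~ null_seq 1.
Proof.
rewrite /null_seq => h; have E : norm2 (1 : M) = 1.
  by rewrite /norm2 star1 mulr1 tr1 /= sqrtr1.
have : norm2 (1 : M) @[n --> ultra_sets U] --> (1 : R) by rewrite E; exact: cvg_cst.
move=> /(cvg_unique (@Rhausdorff R) h) /eqP.
by rewrite eq_sym oner_eq0.
Qed.

Definition ultra_equiv x y := `[< null_seq (x - y) >].

Lemma ultra_equiv_is_equiv : equiv_class_of ultra_equiv.
Proof.
split=> [x|x y|y x z]; first by apply/asboolP; rewrite subrr; exact: null_seq0.
- by apply/asboolP/asboolP => /null_seqN; rewrite opprB.
- move=> /asboolP xy /asboolP yz; apply/asboolP.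
  by have := null_seqD xy yz; rewrite addrA subrK.
Qed.

Canonical ultra_equiv_equiv := EquivRelPack ultra_equiv_is_equiv.
Canonical ultra_equiv_encModRel := defaultEncModRel ultra_equiv.

(* The quotient of l^oo(M) by the ideal of sequences whose 2-norms tend to 0
   along U. *)
Definition ultrapower := {eq_quot ultra_equiv}.

HB.instance Definition _ : EqQuotient (linf M) ultra_equiv ultrapower :=
  EqQuotient.on ultrapower.
HB.instance Definition _ := Choice.on ultrapower.

Lemma ultra_piP x y :
  \pi_ultrapower x = \pi_ultrapower y <-> null_seq (x - y).
Proof.
split=> [/eqP|xy]; first by rewrite piE => /asboolP.
by apply/eqP; rewrite piE; apply/asboolP.
Qed.

Lemma null_repr x : null_seq (x - repr (\pi_ultrapower x)).
Proof. by apply/ultra_piP; rewrite reprK. Qed.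

Definition ultra_zero : ultrapower := lift_cst ultrapower 0.
Definition ultra_one : ultrapower := lift_cst ultrapower 1.
Definition ultra_opp := lift_op1 ultrapower -%R.
Definition ultra_add := lift_op2 ultrapower +%R.
Definition ultra_mul := lift_op2 ultrapower *%R.
Definition ultra_scale (a : R[i]) := lift_op1 ultrapower ( *:%R a).
Definition ultra_star := lift_op1 ultrapower (@linf_star _ _ M).

Canonical ultra_pi_zero := PiConst ultra_zero.
Canonical ultra_pi_one := PiConst ultra_one.

Lemma pi_ultra_opp : {morph \pi : x / - x >-> ultra_opp x}.
Proof.
move=> x; unlock ultra_opp; apply/ultra_piP.
by rewrite -opprD; exact/null_seqN/null_repr.
Qed.
Canonical ultra_pi_opp := PiMorph1 pi_ultra_opp.

Lemma pi_ultra_add : {morph \pi : x y / x + y >-> ultra_add x y}.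
Proof.
move=> x y; unlock ultra_add; apply/ultra_piP.
by rewrite opprD addrACA; exact/null_seqD/null_repr/null_repr.
Qed.
Canonical ultra_pi_add := PiMorph2 pi_ultra_add.

Lemma pi_ultra_mul : {morph \pi : x y / x * y >-> ultra_mul x y}.
Proof.
move=> x y; unlock ultra_mul; apply/ultra_piP.
set x' := repr _; set y' := repr _.
have -> : x * y - x' * y' = (x - x') * y + x' * (y - y').
  by rewrite mulrBl mulrBr addrA subrK.
by apply: null_seqD; [exact/null_seqMr/null_repr|exact/null_seqMl/null_repr].
Qed.
Canonical ultra_pi_mul := PiMorph2 pi_ultra_mul.

Lemma pi_ultra_scale a : {morph \pi : x / a *: x >-> ultra_scale a x}.
Proof.
move=> x; unlock ultra_scale; apply/ultra_piP.
by rewrite -scalerBr; exact/null_seqZ/null_repr.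
Qed.
Canonical ultra_pi_scale a := PiMorph1 (pi_ultra_scale a).

Lemma linf_starD x y : linf_star (x + y) = linf_star x + linf_star y.
Proof. by apply/val_inj/funext => n; exact: starD. Qed.

Lemma linf_starN x : linf_star (- x) = - linf_star x.
Proof. by apply/val_inj/funext => n; exact: starN. Qed.

Lemma pi_ultra_star : {morph \pi : x / linf_star x >-> ultra_star x}.
Proof.
move=> x; unlock ultra_star; apply/ultra_piP.
by rewrite -linf_starN -linf_starD; exact/null_seq_star/null_repr.
Qed.
Canonical ultra_pi_star := PiMorph1 pi_ultra_star.

Fact ultra_addA : associative ultra_add.
Proof. by move=> x y z; rewrite -[x]reprK -[y]reprK -[z]reprK !piE addrA. Qed.
Fact ultra_addC : commutative ultra_add.
Proof. by move=> x y; rewrite -[x]reprK -[y]reprK !piE addrC. Qed.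
Fact ultra_add0 : left_id ultra_zero ultra_add.
Proof. by move=> x; rewrite -[x]reprK !piE add0r. Qed.
Fact ultra_addN : left_inverse ultra_zero ultra_opp ultra_add.
Proof. by move=> x; rewrite -[x]reprK !piE addNr. Qed.

HB.instance Definition _ :=
  GRing.isZmodule.Build ultrapower ultra_addA ultra_addC ultra_add0 ultra_addN.

Fact ultra_mulA : associative ultra_mul.
Proof. by move=> x y z; rewrite -[x]reprK -[y]reprK -[z]reprK !piE mulrA. Qed.
Fact ultra_mul1 : left_id ultra_one ultra_mul.
Proof. by move=> x; rewrite -[x]reprK !piE mul1r. Qed.
Fact ultra_mulr1 : right_id ultra_one ultra_mul.
Proof. by move=> x; rewrite -[x]reprK !piE mulr1. Qed.
Fact ultra_mulDl : left_distributive ultra_mul ultra_add.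
Proof. by move=> x y z; rewrite -[x]reprK -[y]reprK -[z]reprK !piE mulrDl. Qed.
Fact ultra_mulDr : right_distributive ultra_mul ultra_add.
Proof. by move=> x y z; rewrite -[x]reprK -[y]reprK -[z]reprK !piE mulrDr. Qed.
Fact ultra_one_neq0 : ultra_one != ultra_zero.
Proof.
by rewrite piE; apply/asboolP; rewrite subr0; exact: null_seq1.
Qed.

HB.instance Definition _ := GRing.Zmodule_isNzRing.Build ultrapower
  ultra_mulA ultra_mul1 ultra_mulr1 ultra_mulDl ultra_mulDr ultra_one_neq0.

Fact ultra_scaleA a b (x : ultrapower) :
  ultra_scale a (ultra_scale b x) = ultra_scale (a * b) x.
Proof. by rewrite -[x]reprK !piE scalerA. Qed.
Fact ultra_scale1 : left_id 1 ultra_scale.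
Proof. by move=> x; rewrite -[x]reprK !piE scale1r. Qed.
Fact ultra_scaleDr : right_distributive ultra_scale ultra_add.
Proof. by move=> a x y; rewrite -[x]reprK -[y]reprK !piE scalerDr. Qed.
Fact ultra_scaleDl (x : ultrapower) :
  {morph ultra_scale^~ x : a b / a + b >-> ultra_add a b}.
Proof. by move=> a b; rewrite -[x]reprK !piE scalerDl. Qed.

HB.instance Definition _ := GRing.Zmodule_isLmodule.Build R[i] ultrapower
  ultra_scaleA ultra_scale1 ultra_scaleDr ultra_scaleDl.

Fact ultra_scaleAl a (x y : ultrapower) :
  ultra_scale a (ultra_mul x y) = ultra_mul (ultra_scale a x) y.
Proof. by rewrite -[x]reprK -[y]reprK !piE scalerAl. Qed.

HB.instance Definition _ :=
  GRing.Lmodule_isLalgebra.Build R[i] ultrapower ultra_scaleAl.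

Fact ultra_scaleAr a (x y : ultrapower) :
  ultra_scale a (ultra_mul x y) = ultra_mul x (ultra_scale a y).
Proof. by rewrite -[x]reprK -[y]reprK !piE scalerAr. Qed.

HB.instance Definition _ :=
  GRing.Lalgebra_isAlgebra.Build R[i] ultrapower ultra_scaleAr.

Fact ultra_starD : {morph ultra_star : x y / ultra_add x y}.
Proof. by move=> x y; rewrite -[x]reprK -[y]reprK !piE linf_starD. Qed.
Fact ultra_starZ a (x : ultrapower) :
  ultra_star (ultra_scale a x) = ultra_scale a^* (ultra_star x).
Proof.
rewrite -[x]reprK !piE; congr (\pi _).
by apply/val_inj/funext => n; exact: starZ.
Qed.
Fact ultra_starM (x y : ultrapower) :
  ultra_star (ultra_mul x y) = ultra_mul (ultra_star y) (ultra_star x).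
Proof.
rewrite -[x]reprK -[y]reprK !piE; congr (\pi _).
by apply/val_inj/funext => n; exact: starM.
Qed.
Fact ultra_starK : involutive ultra_star.
Proof.
move=> x; rewrite -[x]reprK !piE; congr (\pi _).
by apply/val_inj/funext => n; exact: starK.
Qed.

HB.instance Definition _ := isStarAlgebra.Build R ultrapower
  ultra_starD ultra_starZ ultra_starM ultra_starK.

Local Notation proj := (fun x : linf M => \pi_ultrapower x : ultrapower).

Lemma ultra_pi0 : proj 0 = 0. Proof. by rewrite /= piE. Qed.
Lemma ultra_pi1 : proj 1 = 1. Proof. by rewrite /= piE. Qed.
Lemma ultra_piD x y : proj (x + y) = proj x + proj y.
Proof. exact: pi_ultra_add. Qed.
Lemma ultra_piN x : proj (- x) = - proj x.
Proof. exact: pi_ultra_opp. Qed.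
Lemma ultra_piM x y : proj (x * y) = proj x * proj y.
Proof. exact: pi_ultra_mul. Qed.
Lemma ultra_piZ a x : proj (a *: x) = a *: proj x.
Proof. exact: pi_ultra_scale. Qed.
Lemma ultra_pi_starE x : proj (linf_star x) = star (proj x).
Proof. exact: pi_ultra_star. Qed.

Lemma linf_tr_bounded x : cbounded (fun n => tr (x n)).
Proof.
case: x => x xb /=; have /bounded_seqsP[K K0 b] := xb; exists K => n.
by apply: le_trans (norm_tr_le _) _; rewrite lecR; exact/norm2_bounded/b/ltW.
Qed.

Definition linf_tr x := climit U (fun n => tr (x n)).
Definition ultra_tr (x : ultrapower) : R[i] := linf_tr (repr x).

Lemma linf_trD x y : linf_tr (x + y) = linf_tr x + linf_tr y.
Proof.
rewrite /linf_tr -climitD; try exact: linf_tr_bounded.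
by congr climit; apply/funext => n; exact: trD.
Qed.

Lemma linf_trZ a x : linf_tr (a *: x) = a * linf_tr x.
Proof.
rewrite /linf_tr -climitZ; try exact: linf_tr_bounded.
by congr climit; apply/funext => n; exact: trZ.
Qed.

Lemma linf_tr_null x : null_seq x -> linf_tr x = 0.
Proof. by apply: climit0 => n; exact: norm_tr_le. Qed.

Lemma pi_ultra_tr x : ultra_tr (proj x) = linf_tr x.
Proof.
rewrite /ultra_tr; apply/esym/eqP; rewrite -subr_eq0 -mulN1r -linf_trZ -linf_trD.
by rewrite scaleN1r linf_tr_null //; exact: null_repr.
Qed.

Fact ultra_tr_scalar : scalar ultra_tr.
Proof.
move=> a x y; rewrite -[x]reprK -[y]reprK.
by rewrite -ultra_piZ -ultra_piD !pi_ultra_tr linf_trD linf_trZ.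
Qed.
Fact ultra_tr1 : ultra_tr 1 = 1.
Proof.
rewrite -ultra_pi1 pi_ultra_tr -[RHS](climit_cst U).
by congr climit; apply/funext => n; exact: tr1.
Qed.
Fact ultra_tr_mulC (x y : ultrapower) : ultra_tr (x * y) = ultra_tr (y * x).
Proof.
rewrite -[x]reprK -[y]reprK -!ultra_piM !pi_ultra_tr.
by congr climit; apply/funext => n; exact: tr_mulC.
Qed.

Lemma linf_tr_starM x : linf_tr (linf_star x * x) =
  ((lim (norm2 (x n) ^+ 2 @[n --> ultra_sets U]))%:C)%C.
Proof.
rewrite /linf_tr /climit.
have -> : (fun n => complex.Re (tr ((linf_star x * x : linf M) n))) =
    (fun n => norm2 (x n) ^+ 2) by apply/funext => n; rewrite tr_starM.
have -> : (fun n => complex.Im (tr ((linf_star x * x : linf M) n))) =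
    (fun n => 0) by apply/funext => n; rewrite tr_starM.
by rewrite lim_cst.
Qed.

Lemma linf_norm2_cvg x : cvg (norm2 (x n) ^+ 2 @[n --> ultra_sets U]).
Proof.
case: x => x xb /=; have /bounded_seqsP[K K0 b] := xb.
apply: (@ultra_cvg _ _ _ (K ^+ 2)) => n.
rewrite ger0_norm ?sqr_ge0 // ler_pXn2r ?nnegrE ?norm2_ge0 ?(ltW K0) //.
exact/norm2_bounded/b/ltW.
Qed.

Lemma ultra_tr_starM x : ultra_tr (star (proj x) * proj x) =
  ((lim (norm2 (x n) ^+ 2 @[n --> ultra_sets U]))%:C)%C.
Proof.
by rewrite -ultra_pi_starE -ultra_piM pi_ultra_tr linf_tr_starM.
Qed.

Fact ultra_tr_ge0 (x : ultrapower) : 0 <= ultra_tr (star x * x).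
Proof.
rewrite -[x]reprK ultra_tr_starM ler0c; apply: limr_ge; first exact: linf_norm2_cvg.
by apply: filterE => n; exact: sqr_ge0.
Qed.

Fact ultra_tr_faithful (x : ultrapower) : ultra_tr (star x * x) = 0 -> x = 0.
Proof.
rewrite -[x]reprK ultra_tr_starM => -[x0].
rewrite -ultra_pi0; apply/ultra_piP; rewrite subr0; apply/cvg0_sqr; rewrite -x0.
exact: linf_norm2_cvg.
Qed.

HB.instance Definition _ := isTracial.Build R ultrapower
  ultra_tr_scalar ultra_tr1 ultra_tr_mulC ultra_tr_ge0 ultra_tr_faithful.

End Ultrapower.

Section Properties.
Context {R : realType}.

Definition unitary {A : starAlgType R} (u : A) :=
  star u * u = 1 /\ u * star u = 1.

Definition star_hom {A B : starAlgType R} (f : A -> B) :=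
  [/\ linear f, f 1 = 1, {morph f : x y / x * y} & {morph f : x / star x}].

Definition embedding {A B : tracialAlgType R} (f : A -> B) :=
  star_hom f /\ forall x, tr (f x) = tr x.

Context {H : hilbertType R}.
Variable M : tracialVonNeumannType H.

Definition ultra_class (U : free_ultrafilter) (x : linf M) : ultrapower M U :=
  \pi_(ultrapower M U) x.

Definition diagonal_embedding (U : free_ultrafilter) (x : M) : ultrapower M U :=
  ultra_class U (linf_const x).

Definition separable := exists2 D : set M, countable D &
  forall (x : M) (e : R), 0 < e -> exists2 d, D d & norm2 (x - d) < e.

Definition jung_property :=
  forall (U : free_ultrafilter) (f : M -> ultrapower M U), embedding f ->
    exists2 u : ultrapower M U, unitary u &
      forall x : M, u * f x * star u = diagonal_embedding U x.

Definition weak_jung_property :=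
  forall f : M -> M, embedding f ->
    forall (F : seq M) (e : R), 0 < e ->
      exists2 v : M, unitary v &
        forall x, x \in F -> norm2 (v * f x * star v - x) < e.

(* Unital *-homomorphisms of M are contractive, so the sequence (g i x)_i is
   automatically in l^oo(M); [s] is that sequence as an element of l^oo(M). *)
Definition self_tracially_stable :=
  forall (U : free_ultrafilter) (f : M -> ultrapower M U), embedding f ->
    exists2 g : nat -> M -> M, forall i, star_hom (g i) &
      forall x : M, exists2 s : linf M,
        forall i, s i = g i x & f x = ultra_class U s.

End Properties.

(* Main.v *)
Require Import Defs.
From HB Require Import structures.
From mathcomp Require Import all_boot all_order all_algebra.
From mathcomp Require Import all_classical all_reals.
From mathcomp Require Import sesquilinear complex generic_quotient.
From mathcomp Require Import topology normedtype sequences.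
From mathcomp Require Import ring lra.
From Stdlib Require Ncring Ncring_tac.

(** Suppose first that [M] has the Jung property. An endomorphism followed by
    the diagonal embedding is an embedding into the ultrapower, so it is
    conjugate to the diagonal embedding by a unitary [u] of the ultrapower; an
    arbitrary embedding [f] satisfies [f x = star u * x * u]. Both conclusions
    follow once [u] is represented by a sequence of unitaries [w n] of [M]: the
    [w n] witness approximate innerness, and the inner automorphisms
    [x |-> star (w n) * x * w n] lift [f].

    Conversely, let [f] be lifted by star-homomorphisms [g n : M -> M]. If each
    [g n] is an endomorphism in the sense of embeddings, the weak Jung property
    provides unitaries [v n] that undo [g n] on the first [n] members of a dense
    sequence up to [1 / n], and the class of [v] conjugates [f] to the diagonal
    embedding on the dense sequence, hence everywhere by continuity in 2-norm.

    Two facts on II_1 factors carry the argument.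

    - Unitaries of the ultrapower lift ([unitary_lift]). Every [a] lies within
      a constant times the 2-norm of [star a * a - 1] of a unitary
      ([unitary_approx]): cut [a] by the spectral projection [p] of [star a * a]
      for the half-line above [1/4], take the partial isometry [v] of the polar
      decomposition of [a p], and complete [v] to a unitary by a partial isometry
      between the complements of its two projections. These complements have
      the same trace, which is small, so they are equivalent and the completion
      costs little.

    - A star-homomorphism [g : M -> M] preserves the trace, because [tr \o g] is
      a tracial state and [tr] is the only one ([tracial_state_unique]). As
      [tr \o g] is not known to be normal, averaging in 2-norm is not available.
      Instead let [phi] be a tracial state and [C > 1]. A maximality argument
      exhausts the part of the unit where [phi] is at least [C * tr]; since
      [phi 1 < C], something nonzero is left, and below it [phi <= C * tr]. It
      dominates a multiple of a nonzero projection [q]. By comparison of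
      projections the unit is a finite sum of elements [star c * c] with
      [q * c = c], so the trace identity transports the bound to all of [M].
      Letting [C] tend to [1] gives [phi <= tr] on positive elements, and
      [phi 1 = tr 1] forces equality.

    The operator theory used is developed from the double commutant property:
    bounded increasing sequences converge strongly in [M] ([monotone_limit]),
    which yields square roots, spectral projections ([spectral_cut]), inverses,
    and polar decomposition ([polar_cut]). All exhaustion arguments, including
    comparison of projections ([comparison]), are instances of one maximality
    principle driven by the trace ([brezis_browder]). *)

Set Implicit Arguments.
Unset Strict Implicit.
Unset Printing Implicit Defensive.
Import Order.TTheory GRing.Theory Num.Theory.
Import numFieldNormedType.Exports.
Local Open Scope classical_set_scope.
Local Open Scope ring_scope.

(** * Identities in noncommutative rings and positive elements *)

Section NoncommutativeRing.
Context {A : pzRingType}.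

#[local] Instance pzRing_ops : @Ncring.Ring_ops A 0%R 1%R +%R *%R
  (fun x y => x - y)%R -%R (@eq A) := {}.

#[local] Instance pzRing_ring : Ncring.Ring (Ro := pzRing_ops).
Proof.
split; try exact _; try (by move=> ? ? -> ? ? ->); try (by move=> ? ? ->).
- exact: add0r.
- exact: addrC.
- exact: addrA.
- exact: mul1r.
- exact: mulr1.
- exact: mulrA.
- exact: mulrDl.
- by move=> x y z; exact: mulrDr.
- by [].
- exact: subrr.
Qed.
End NoncommutativeRing.
#[local] Existing Instance pzRing_ops.
#[local] Existing Instance pzRing_ring.
(** Elements of [M] do not commute, and identities between them occur throughout. *)
Ltac ncring := rewrite ?expr2 ?mulr2n; Ncring_tac.non_commutative_ring.

Section VonNeumannTheory.
Context {R : realType} {H : hilbertType R} {M : tracialVonNeumannType H}.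
Implicit Types (x y a b p : M) (u v w : H).

Lemma actN x v : act (- x) v = - act x v.
Proof. by rewrite -scaleN1r actZ scaleN1r. Qed.

Lemma actB x y v : act (x - y) v = act x v - act y v.
Proof. by rewrite actD actN. Qed.

Lemma actDr x v w : act x (v + w) = act x v + act x w.
Proof.
have : range (act : M -> H -> H) (act x) by [].
rewrite -act_bicommutant => -[[lin _] _].
by have := lin 1 v w; rewrite !scale1r.
Qed.

Lemma innerC v w : inner v w = (inner w v)^*.
Proof. by rewrite hermC expr0 mul1r. Qed.

Lemma actZr x (c : R[i]) v : act x (c *: v) = c *: act x v.
Proof.
have : range (act : M -> H -> H) (act x) by [].
rewrite -act_bicommutant => -[[lin _] _].
have x0 : act x 0 = 0 by have := lin (-1) 0 0; rewrite !scaleN1r !addNr.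
by have := lin c v 0; rewrite x0 !addr0.
Qed.

(** Polarization: the form [inner (act x v) w] is recovered from its diagonal
    because the scalars contain ['i]. *)
Lemma act_eq0_form x : (forall v, inner (act x v) v = 0) -> x = 0.
Proof.
move=> x0; apply/act_inj/funext => v.
rewrite act0; apply/eqP; rewrite -(dnorm_eq0 inner).
have P w : inner (act x v) w + inner (act x w) v = 0.
  have := x0 (v + w); rewrite actDr linearDl !linearDr /= !x0.
  by rewrite add0r addr0.
have := P (act x v); have := P ('i *: act x v).
rewrite actZr linearZl_LR linearZr_LR /= conjCi mulNr => /eqP.
rewrite addrC subr_eq0 => /eqP /(mulfI (neq0Ci _)) ->.
by rewrite -mulr2n => /eqP; rewrite mulrn_eq0.
Qed.

Lemma act_eq_form x y : (forall v, inner (act x v) v = inner (act y v) v) -> x = y.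
Proof.
move=> xy; apply/eqP; rewrite -subr_eq0; apply/eqP/act_eq0_form => v.
by rewrite actB linearBl /= xy subrr.
Qed.

Lemma positive_star x : positive x -> star x = x.
Proof.
move=> x0; apply: act_eq_form => v; rewrite act_star innerC.
by apply: geC0_conj; exact: x0.
Qed.

Lemma positive0 : positive (0 : M).
Proof. by move=> v; rewrite act0 linear0l. Qed.

Lemma positiveD x y : positive x -> positive y -> positive (x + y).
Proof. by move=> x0 y0 v; rewrite actD linearDl /= addr_ge0. Qed.

Lemma positiveZ (c : R[i]) x : 0 <= c -> positive x -> positive (c *: x).
Proof. by move=> c0 x0 v; rewrite actZ linearZl_LR /= mulr_ge0. Qed.

Lemma positive_conj b x : positive x -> positive (star b * x * b).
Proof. by move=> x0 v; rewrite !actM act_star. Qed.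

Lemma positive_starM b : positive (star b * b).
Proof. by move=> v; rewrite actM act_star dnorm_ge0. Qed.

Lemma positive1 : positive (1 : M).
Proof. by move=> v; rewrite act1 dnorm_ge0. Qed.

Lemma positive_sqr x : star x = x -> positive (x * x).
Proof. by move=> {1}<-; exact: positive_starM. Qed.

Lemma positive_sandwich b x : star b = b -> positive x -> positive (b * x * b).
Proof. by move=> {1}<-; exact: positive_conj. Qed.

Lemma positive_trans x y z : positive (y - x) -> positive (z - y) -> positive (z - x).
Proof.
have -> : z - x = (y - x) + (z - y) by ncring.
exact: positiveD.
Qed.

Lemma positive_antisym x : positive x -> positive (- x) -> x = 0.
Proof.
move=> x0 xN; apply: act_eq0_form => v; apply/eqP; rewrite eq_le x0 andbT.
by have := xN v; rewrite actN linearNl oppr_ge0.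
Qed.

End VonNeumannTheory.

(** * Strong limits *)

Section StrongLimits.
Context {R : realType} {H : hilbertType R} {M : tracialVonNeumannType H}.
Implicit Types (x y a b p : M) (u v w : H).

Definition strong_cvg (x : nat -> M) (s : M) :=
  forall v, act (x n) v @[n --> \oo] --> act s v.

Lemma gt0_realC (e : R[i]) : 0 < e -> exists2 r : R, 0 < r & e = (r%:C)%C.
Proof.
move=> e0; exists (complex.Re e); last by rewrite RRe_real ?gtr0_real.
by move: e0; rewrite ltcE => /andP[].
Qed.

(** The pointwise limit commutes with the commutant of [M], since elements of
    the commutant are continuous; so it belongs to the double commutant. The
    bounded real sequence [g v] controls the Cauchy property at [v]. *)
Lemma strong_limit_ex (x : nat -> M) (K : R) (g : H -> nat -> R) (B : H -> R) :
  (forall n, op_bounded K (x n)) ->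
  (forall v n m, (n <= m)%N ->
    `|act (x m) v - act (x n) v| ^+ 2 <= ((g v m - g v n)%:C)%C) ->
  (forall v n, g v n <= B v) ->
  exists2 s : M, op_bounded K s & strong_cvg x s.
Proof.
move=> xK xg gB.
have xc v : cvg (act (x n) v @[n --> \oo]).
  apply/cauchy_cvgP/cauchyP => e /gt0_realC[r r0 ->].
  have [_ [n0 _ <-] n0r] : exists2 t, range (g v) t & sup (range (g v)) - r ^+ 2 < t.
    apply: sup_adherent; rewrite ?exprn_gt0 //; split; first by exists (g v 0), 0.
    by exists (B v) => _ [n _ <-].
  exists (act (x n0) v); exists n0 => // m /= n0m.
  rewrite -ball_normE /= distrC -(@ltr_pXn2r _ 2) ?nnegrE ?ler0c ?normr_ge0 ?(ltW r0) //.
  apply: (le_lt_trans (xg v _ _ n0m)); rewrite -rmorphXn /= ltcR.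
  rewrite ltrBlDr -ltrBlDl; apply: (le_lt_trans _ n0r); rewrite lerD2r //.
  apply: ub_le_sup; last by exists m.
  by exists (B v) => _ [n _ <-].
pose T v : H := lim (act (x n) v @[n --> \oo]).
have TP : forall v, act (x n) v @[n --> \oo] --> T v := xc.
have TE v w : act (x n) v @[n --> \oo] --> w -> T v = w.
  by move=> h; apply: cvg_lim h; exact: norm_hausdorff.
have Tlin : linear T.
  move=> c v w; apply: TE.
  under eq_fun do rewrite actDr actZr.
  by apply: cvgD; [apply: cvgZl_tmp; exact: TP|exact: TP].
have Tb v : `|T v| <= (K%:C)%C * `|v|.
  apply/ler_addgt0Pr => e e0.
  have /cvgrPdist_le/(_ e e0)[n _ /(_ n (leqnn n))] := TP v; rewrite /= => h.
  rewrite -[T v](subrK (act (x n) v)) addrC.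
  by apply: (le_trans (ler_normD _ _)); rewrite lerD // xK.
pose f : {linear H -> H} := HB.pack T (GRing.isLinear.Build _ _ _ _ _ Tlin).
have Tc : continuous T.
  apply/(@linear_bounded_continuous _ _ _ f).
  apply/linear_boundedP; exists (`|K|%:C)%C; split.
    by apply: ger0_real; rewrite ler0c.
  move=> r Kr v; apply: (le_trans (Tb v)); rewrite ler_wpM2r //.
  by apply: le_trans (ltW Kr); rewrite lecR ler_norm.
have : commutant (commutant (range (act : M -> H -> H))) T.
  split=> // S [[Slin Sc] SM]; apply/funext => v /=; apply: TE.
  have E n : act (x n) (S v) = S (act (x n) v).
    by have /(congr1 (fun h => h v)) := SM (act (x n)) (imageT _ _).
  under eq_fun do rewrite E.
  by apply: continuous_cvg; [exact: Sc|exact: TP].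
rewrite act_bicommutant => -[s _ sT]; exists s => z; rewrite sT; first exact: Tb.
exact: TP.
Qed.

End StrongLimits.

(** * Monotone limits and the trace *)

Section MonotoneLimits.
Context {R : realType} {H : hilbertType R} {M : tracialVonNeumannType H}.
Implicit Types (x y a b p s : M) (u v w : H).

Lemma cauchy_schwarz v w : `|inner v w| ^+ 2 <= `|v| ^+ 2 * `|w| ^+ 2.
Proof.
have [->|w0] := eqVneq w 0; first by rewrite linear0r !normr0 expr0n /= mulr0.
have w1 : 0 < inner w w by rewrite dnorm_gt0.
rewrite -!inner_norm -(ler_pM2r w1).
have := dnorm_ge0 inner (inner w w *: v - inner v w *: w).
rewrite dnormB !dnormZ !linearZl_LR !linearZr_LR /=.
rewrite (ger0_norm (ltW w1)) !rmorphM /= !conjCK.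
rewrite (CrealP (gtr0_real w1)) normCK.
move: (inner v w) (inner w w) (inner v v) => c d e h; rewrite -subr_ge0.
by apply: le_trans h _; rewrite le_eqVlt; apply/orP; left; apply/eqP; ring.
Qed.

Lemma strong_cvgP (x : nat -> M) s : strong_cvg x s <->
  forall v (e : R), 0 < e -> exists N, forall n, (N <= n)%N ->
    `|act (x n) v - act s v| <= (e%:C)%C.
Proof.
split=> [xs v e e0|xs v].
  have e1 : 0 < (e%:C)%C by rewrite ltcR.
  have /cvgrPdist_le/(_ _ e1)[N _ h] := xs v.
  by exists N => n Nn; rewrite distrC; exact: h.
apply/cvgrPdist_le => _ /gt0_realC[e e0 ->].
have [N h] := xs v e e0; exists N => // n /= Nn.
by rewrite distrC; exact: h.
Qed.

(** Strong convergence implies weak convergence, by Cauchy--Schwarz. *)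
Lemma strong_cvg_inner (x : nat -> M) s v w (e : R) : strong_cvg x s -> 0 < e ->
  exists N, forall n, (N <= n)%N ->
    `|inner (act (x n) v) w - inner (act s v) w| <= (e%:C)%C.
Proof.
move=> /strong_cvgP xs e0.
have w0 : 0 < complex.Re `|w| + 1.
  by apply: ltr_wpDl => //; have := normr_ge0 w; rewrite lecE => /andP[].
have [N h] := xs v (e / (complex.Re `|w| + 1)) (divr_gt0 e0 w0).
exists N => n /h {}h.
rewrite -linearBl /= -(@ler_pXn2r _ 2) ?nnegrE ?normr_ge0 ?ler0c ?(ltW e0) //.
apply: le_trans (cauchy_schwarz _ _) _.
rewrite -exprMn ler_pXn2r ?nnegrE ?mulr_ge0 ?normr_ge0 ?ler0c ?(ltW e0) //.
have -> : e = e / (complex.Re `|w| + 1) * (complex.Re `|w| + 1).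
  by rewrite divfK // gt_eqF.
rewrite rmorphM /=; apply: ler_pM => //.
by rewrite -[leLHS]RRe_real ?normr_real // lecR lerDl.
Qed.

Lemma strong_cvg_positive (x : nat -> M) s : strong_cvg x s ->
  (forall n, positive (x n)) -> positive s.
Proof.
move=> xs x0 v.
have P (e : R) : 0 < e -> `|complex.Im (inner (act s v) v)| <= e /\
    - e <= complex.Re (inner (act s v) v).
  move=> e0; have [N /(_ N (leqnn N))] := strong_cvg_inner v v xs e0.
  have := x0 N v; move: (inner (act s v) v) (inner (act (x N) v) v).
  case=> a b [c d]; rewrite lecE /= => /andP[/eqP -> c0] h.
  have /le_trans/(_ h) := normc_ge_Re ((c +i* 0)%C - (a +i* b)%C).
  have /le_trans/(_ h) := normc_ge_Im ((c +i* 0)%C - (a +i* b)%C).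
  rewrite !lecR /= add0r normrN => bI; rewrite ler_norml => /andP[_ bR].
  by split=> //; lra.
rewrite lecE /= -normr_le0; apply/andP; split.
  by apply/ler_addgt0Pr => e e0; rewrite add0r; have [] := P e e0.
by apply/ler_addgt0Pr => e e0; rewrite -lerBlDr sub0r; have [] := P e e0.
Qed.

Lemma strong_cvg_unique (x : nat -> M) s t : strong_cvg x s -> strong_cvg x t -> s = t.
Proof.
move=> xs xt; apply/act_inj/funext => v.
exact: (@cvg_unique _ (@norm_hausdorff _ _) _ _ _ _ (xs v) (xt v)).
Qed.

Lemma strong_cvg_cst a : strong_cvg (fun=> a) a.
Proof. by move=> v; exact: cvg_cst. Qed.

Lemma strong_cvgD (x y : nat -> M) s t : strong_cvg x s -> strong_cvg y t ->
  strong_cvg (fun n => x n + y n) (s + t).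
Proof.
by move=> xs yt v; rewrite actD; under eq_fun do rewrite actD; apply: cvgD.
Qed.

Lemma strong_cvgZ c (x : nat -> M) s : strong_cvg x s ->
  strong_cvg (fun n => c *: x n) (c *: s).
Proof.
by move=> xs v; rewrite actZ; under eq_fun do rewrite actZ; apply: cvgZl_tmp.
Qed.

Lemma strong_cvgB (x y : nat -> M) s t : strong_cvg x s -> strong_cvg y t ->
  strong_cvg (fun n => x n - y n) (s - t).
Proof.
move=> xs yt; rewrite -[- t]scaleN1r; under eq_fun do rewrite -[- y _]scaleN1r.
exact/strong_cvgD/strong_cvgZ.
Qed.

Lemma strong_cvgS (x : nat -> M) s : strong_cvg x s -> strong_cvg (fun n => x n.+1) s.
Proof.
move=> /strong_cvgP xs; apply/strong_cvgP => v e e0; have [N h] := xs v e e0.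
by exists N => n Nn; apply: h; exact: leqW.
Qed.

(** Multiplication is jointly strongly continuous only on bounded sets, whence
    the uniform bound on the left factors. *)
Lemma strong_cvgM (K : R) (x y : nat -> M) s t : 0 <= K -> (forall n, op_bounded K (x n)) ->
  strong_cvg x s -> strong_cvg y t -> strong_cvg (fun n => x n * y n) (s * t).
Proof.
move=> K0 xK /strong_cvgP xs /strong_cvgP yt; apply/strong_cvgP => v e e0.
have K1 : 0 < K + 1 by exact: ltr_wpDl.
have e2 : 0 < e / 2 / (K + 1) by rewrite !divr_gt0.
have e3 : 0 < e / 2 by rewrite divr_gt0.
have [N h] := yt v _ e2; have [N' h'] := xs (act t v) _ e3.
exists (maxn N N') => n; rewrite geq_max => /andP[/h {}h /h' {}h'].
have -> : act (x n * y n) v - act (s * t) v =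
    act (x n) (act (y n) v - act t v) + (act (x n) (act t v) - act s (act t v)).
  by rewrite !actM -(scaleN1r (act t v)) actDr actZr scaleN1r addrA subrK.
apply: le_trans (ler_normD _ _) _.
have -> : e = (K + 1) * (e / 2 / (K + 1)) + e / 2.
  rewrite mulrC divfK ?gt_eqF //; lra.
rewrite rmorphD lerD //=.
apply: le_trans (xK _ _) _; rewrite rmorphM /=; apply: ler_pM => //.
  by rewrite ler0c.
by rewrite lecR lerDl.
Qed.

Lemma strong_cvgMl b (x : nat -> M) s : strong_cvg x s -> strong_cvg (fun n => b * x n) (b * s).
Proof.
have [K bK] := op_bounded_ex b.
apply: (@strong_cvgM `|K|) => // [_|]; last exact: strong_cvg_cst.
by apply: op_boundedW bK; exact: ler_norm.
Qed.

Lemma strong_cvgMr b (x : nat -> M) s : strong_cvg x s -> strong_cvg (fun n => x n * b) (s * b).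
Proof. by move=> xs v; rewrite actM; under eq_fun do rewrite actM; exact: xs. Qed.

(** The identity [a - a ^ 2 = a (1 - a) a + (1 - a) a (1 - a)] makes positivity
    visible without a square root. *)
Lemma positive_sub_sqr a : positive a -> positive (1 - a) -> positive (a - a * a).
Proof.
move=> a0 a1; have -> : a - a * a = a * (1 - a) * a + (1 - a) * a * (1 - a).
  by ncring.
by apply: positiveD; apply: positive_sandwich => //; exact: positive_star.
Qed.

Lemma form_star a v : inner (act (star a * a) v) v = `|act a v| ^+ 2.
Proof. by rewrite actM act_star -inner_norm. Qed.

Lemma op_bounded_starM a (K : R) : 0 <= K ->
  positive (((K ^+ 2)%:C)%C *: 1 - star a * a) -> op_bounded K a.
Proof.
move=> K0 aK v; have := aK v; rewrite actB linearBl /= form_star actZ linearZl_LR.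
rewrite /= act1 (inner_norm v) subr_ge0 rmorphXn /= -exprMn.
by rewrite ler_pXn2r ?nnegrE ?mulr_ge0 ?normr_ge0 ?ler0c.
Qed.

Lemma op_bounded_contraction a : positive a -> positive (1 - a) -> op_bounded 1 a.
Proof.
move=> a0 a1; apply: op_bounded_starM => //.
rewrite expr1n scale1r (positive_star a0).
exact: positive_trans (positive_sub_sqr a0 a1) a1.
Qed.

Lemma positive_mono (x : nat -> M) : (forall n, positive (x n.+1 - x n)) ->
  forall n m, (n <= m)%N -> positive (x m - x n).
Proof.
move=> xS n; elim=> [|m IH]; first by rewrite leqn0 => /eqP ->; rewrite subrr; exact: positive0.
rewrite leq_eqVlt => /predU1P[->|/IH]; first by rewrite subrr; exact: positive0.
by move=> /positive_trans; apply.
Qed.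

(** For [n <= m] the difference [a = x m - x n] is a positive contraction, so
    [a ^ 2 <= a] bounds the square of the norm of [a v] by the increment of the
    bounded sequence [inner (x n v) v]. *)
Lemma monotone_limit (x : nat -> M) :
  (forall n, positive (x n)) -> (forall n, positive (x n.+1 - x n)) ->
  (forall n, positive (1 - x n)) ->
  exists s, [/\ strong_cvg x s, forall n, positive (s - x n), positive (1 - s),
    positive s & op_lub (range x) s].
Proof.
move=> x0 /positive_mono xS x1.
have [|v n m nm|v n|s _ xs] := @strong_limit_ex _ _ _ x 1
    (fun v n => complex.Re (inner (act (x n) v) v)) (fun v => complex.Re (inner v v)).
- by move=> n; apply: op_bounded_contraction.
- have a0 := xS _ _ nm; set a := x m - x n in a0 *.
  have a1 : positive (1 - a).
    have -> : 1 - a = (1 - x m) + x n by rewrite /a; ncring.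
    exact: positiveD.
  have := positive_sub_sqr a0 a1 v.
  rewrite -{2}(positive_star a0) actB linearBl /= form_star subr_ge0 -actB => /le_trans; apply.
  rewrite actB linearBl /= -[leLHS]RRe_real ?raddfB //.
  by rewrite realB // ger0_real //; exact: x0.
- have := x1 n v; rewrite actB linearBl /= act1 subr_ge0 lecE => /andP[] //.
have sx n : positive (s - x n).
  apply: (@strong_cvg_positive (fun m => x (n + m)%N - x n)) => [|m].
    apply: strong_cvgB; last exact: strong_cvg_cst.
    move/strong_cvgP in xs; apply/strong_cvgP => v e e0; have [N h] := xs v e e0.
    by exists N => m Nm; apply/h/(leq_trans Nm)/leq_addl.
  by apply/xS/leq_addr.
have le_s t : (forall n, positive (t - x n)) -> positive (t - s).
  move=> h; apply: strong_cvg_positive h.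
  by apply: strong_cvgB xs; exact: strong_cvg_cst.
exists s; split=> //; first exact: le_s.
  exact: strong_cvg_positive xs x0.
by split=> [_ [n _ <-]|t h]; [exact: sx|apply: le_s => n; apply: h; exists n].
Qed.

(** Comparisons of traces are made in the real field, where linear arithmetic
    applies. *)
Definition rtr x : R := complex.Re (tr x).

Lemma rtrD x y : rtr (x + y) = rtr x + rtr y.
Proof. by rewrite /rtr trD raddfD. Qed.

Lemma rtrN x : rtr (- x) = - rtr x.
Proof. by rewrite /rtr trN raddfN. Qed.

Lemma rtrB x y : rtr (x - y) = rtr x - rtr y.
Proof. by rewrite rtrD rtrN. Qed.

Lemma rtrZ (c : R) x : rtr ((c%:C)%C *: x) = c * rtr x.
Proof. by rewrite /rtr trZ; case: (tr x) => ? ? /=; rewrite mul0r subr0. Qed.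

Lemma rtr1 : rtr (1 : M) = 1.
Proof. by rewrite /rtr tr1. Qed.

Lemma rtr_mulC x y : rtr (x * y) = rtr (y * x).
Proof. by rewrite /rtr tr_mulC. Qed.

Lemma rtr_ge0 x : positive x -> 0 <= rtr x.
Proof. by move=> /tr_positive; rewrite lecE => /andP[]. Qed.

Lemma rtr_le x y : positive (y - x) -> rtr x <= rtr y.
Proof. by move=> /rtr_ge0; rewrite rtrB subr_ge0. Qed.

Lemma rtr_starM x : rtr (star x * x) = norm2 x ^+ 2.
Proof. by rewrite /rtr tr_starM. Qed.

Lemma norm2_eq0 x : norm2 x = 0 -> x = 0.
Proof. by move=> x0; apply: tr_faithful; rewrite tr_starM x0 expr0n. Qed.

Lemma starM_eq0 x : star x * x = 0 -> x = 0.
Proof.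
by move=> x0; apply: norm2_eq0; apply/eqP; rewrite -sqrf_eq0 -rtr_starM x0 /rtr tr0.
Qed.

(** Normality of the trace, in the form in which it is used below. *)
Lemma rtr_monotone_limit (x : nat -> M) s (e : R) :
  (forall n, positive (x n)) -> (forall n, positive (x n.+1 - x n)) ->
  op_lub (range x) s -> 0 < e -> exists n, rtr s - e < rtr (x n).
Proof.
move=> x0 /positive_mono xS xs e0.
have dx : directed (range x).
  split; first by exists (x 0), 0.
  move=> _ _ [n _ <-] [m _ <-]; exists (x (maxn n m)); first by exists (maxn n m).
  by split; apply: xS; [exact: leq_maxl|exact: leq_maxr].
have x0' y : range x y -> positive y by move=> [n _ <-].
have := @tr_normal R H M (range x) s dx x0' xs; rewrite -/(rtr s) => ->.
have [|_ [_ [n _ <-] <-] h] := @sup_adherent _ [set complex.Re (tr y) | y in range x] e e0.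
  split; first by exists (rtr (x 0)), (x 0) => //; exists 0.
  exists (rtr s) => _ [_ [n _ <-] <-]; apply: rtr_le; apply: xs.1; exists n => //.
by exists n.
Qed.

End MonotoneLimits.

(** * Square roots of positive elements *)

Section FunctionalCalculus.
Context {R : realType} {H : hilbertType R} {M : tracialVonNeumannType H}.
Implicit Types (x y a b c h p r s t z : M) (u v w : H).

Definition contraction x := positive x /\ positive (1 - x).

Lemma contraction_star x : contraction x -> star x = x.
Proof. by case=> /positive_star. Qed.

Lemma positiveX a n : positive a -> positive (a ^+ n).
Proof.
move=> a0; have [m] := ubnP n; elim: m n => // m IH [|[|n]] nm.
- by rewrite expr0; exact: positive1.
- by rewrite expr1.
rewrite exprS exprSr mulrA; apply: positive_sandwich; first exact: positive_star.
by apply: IH; rewrite -ltnS ltnW.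
Qed.

Lemma positive_sum (I : Type) (l : seq I) (F : I -> M) :
  (forall i, positive (F i)) -> positive (\sum_(i <- l) F i).
Proof. by move=> F0; elim/big_rec: _ => [|i y _]; [exact: positive0|exact: positiveD]. Qed.

Lemma positive_horner a (q : {poly R[i]}) : positive a ->
  (forall i, 0 <= q`_i) -> positive (horner_alg a q).
Proof.
move=> a0 q0; rewrite -[q]coefK poly_def rmorph_sum; apply: positive_sum => i.
rewrite /= linearZ /= rmorphXn /= horner_algX.
rewrite mulr_algl; apply: positiveZ; [exact: q0|exact: positiveX].
Qed.

(** The Riesz--Nagy iteration: with [a = 1 - x], the increasing limit [z] solves
    [2 z = a + z ^ 2], that is [(1 - z) ^ 2 = x]. *)
Fixpoint sqrt_iter a (n : nat) : M :=
  if n is m.+1 then (2^-1 : R[i]) *: (a + sqrt_iter a m * sqrt_iter a m) else 0.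

Lemma half_ge0 : 0 <= 2^-1 :> R[i]. Proof. by rewrite invr_ge0. Qed.

Lemma halfD x : (2^-1 : R[i]) *: (x + x) = x.
Proof. by rewrite scalerDr -scalerDl -[2^-1]mul1r -splitr scale1r. Qed.

(** Successive differences of the iterates are polynomials in [a] with
    nonnegative coefficients, and these are positive when [a] is. *)
Lemma sqrt_iter_mono a n : positive a ->
  positive (sqrt_iter a n) /\ positive (sqrt_iter a n.+1 - sqrt_iter a n).
Proof.
move=> a0; pose q := fix q n : {poly R[i]} :=
  if n is m.+1 then 2^-1 *: ('X + q m ^+ 2) else 0.
have E m : sqrt_iter a m = horner_alg a (q m).
  elim: m => [|m IH] /=; first by rewrite rmorph0.
  by rewrite linearZ /= mulr_algl rmorphD /= horner_algX rmorphXn /= -IH expr2.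
have X0 i : 0 <= ('X : {poly R[i]})`_i by rewrite coefX ler0n.
have D0 (f g : {poly R[i]}) : (forall i, 0 <= f`_i) -> (forall i, 0 <= g`_i) ->
    forall i, 0 <= (f + g)`_i by move=> f0 g0 i; rewrite coefD addr_ge0.
have M0 (f g : {poly R[i]}) : (forall i, 0 <= f`_i) -> (forall i, 0 <= g`_i) ->
    forall i, 0 <= (2^-1 *: (f * g))`_i.
  move=> f0 g0 i; rewrite coefZ mulr_ge0 ?half_ge0 // coefM sumr_ge0 // => j _.
  exact: mulr_ge0.
have q0 m : forall i, 0 <= (q m)`_i.
  elim: m => [|m IH] /= i; first by rewrite coef0.
  by rewrite scalerDr D0 // => j; [rewrite coefZ mulr_ge0 ?half_ge0|exact: M0].
split; rewrite !E; first by apply: positive_horner.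
rewrite -rmorphB; apply: positive_horner => //.
elim: n => [|m IH]; first by rewrite subr0; exact: q0 1%N.
have -> : q m.+2 - q m.+1 = 2^-1 *: ((q m.+1 - q m) * (q m.+1 + q m)).
  have S k : q k.+1 = 2^-1 *: ('X + q k ^+ 2) by [].
  by rewrite (S m.+1) [X in _ - X = _]S -scalerBr; congr (_ *: _); ring.
by apply: M0; [exact: IH|apply: D0].
Qed.

Lemma sqrt_iter_le1 a n : contraction a -> positive (1 - sqrt_iter a n).
Proof.
move=> [a0 a1]; elim: n => [|n IH]; first by rewrite subr0; exact: positive1.
rewrite /= -[1 in X in positive X]halfD -scalerBr; apply: positiveZ; first exact: half_ge0.
have [z0 _] := sqrt_iter_mono n a0; set z := sqrt_iter a n in IH z0 *.
have -> : 1 + 1 - (a + z * z) = (1 - a) + ((1 - z) + (z - z * z)) by ncring.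
by apply: positiveD => //; apply: positiveD => //; exact: positive_sub_sqr.
Qed.

Lemma sqrt_iter_comm a b n : b * a = a * b -> b * sqrt_iter a n = sqrt_iter a n * b.
Proof.
move=> ba; elim: n => [|n IH] /=; first by rewrite mulr0 mul0r.
rewrite -scalerAr -scalerAl mulrDr mulrDl ba; congr (_ *: (_ + _)).
by rewrite mulrA IH -!mulrA IH.
Qed.

(** The approximating sequence is part of the conclusion because order properties
    of the absolute value are read off from it. *)
Lemma sqrt_contraction x : contraction x ->
  exists s, [/\ contraction s, s * s = x,
    forall b, b * x = x * b -> b * s = s * b &
    strong_cvg (fun n => 1 - sqrt_iter (1 - x) n) s].
Proof.
move=> [x0 x1]; set a := 1 - x.
have ca : contraction a by split=> //; rewrite opprB addrC subrK.
have [||n|z [za _ z1 z0 _]] := @monotone_limit _ _ _ (sqrt_iter a).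
- by move=> n; have [] := sqrt_iter_mono n x1.
- by move=> n; have [] := sqrt_iter_mono n x1.
- exact: sqrt_iter_le1.
have zE : z = (2^-1 : R[i]) *: (a + z * z).
  apply: strong_cvg_unique (strong_cvgS za) _ => /=.
  apply/strong_cvgZ/strong_cvgD; first exact: strong_cvg_cst.
  apply: (@strong_cvgM _ _ _ 1) => // n; apply: op_bounded_contraction.
    by have [] := sqrt_iter_mono n x1.
  exact: sqrt_iter_le1.
have z2 : z + z = a + z * z by rewrite {1 2}zE -scalerDr halfD.
exists (1 - z); split.
- by split=> //; rewrite opprB addrC subrK.
- have -> : (1 - z) * (1 - z) = 1 + z * z - (z + z) by ncring.
  by rewrite z2 /a; ncring.
- move=> b bx; have bz : b * z = z * b.
    apply: (strong_cvg_unique (strong_cvgMl (b := b) za)).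
    have -> : (fun n => b * sqrt_iter a n) = (fun n => sqrt_iter a n * b).
      by apply/funext => n; apply: sqrt_iter_comm; rewrite mulrBr mulrBl bx mulr1 mul1r.
    exact: strong_cvgMr.
  by rewrite mulrBr mulrBl bz mulr1 mul1r.
- by apply: strong_cvgB za; exact: strong_cvg_cst.
Qed.

Lemma op_bounded_le_cst x (K : R) : 0 <= K -> star x = x -> op_bounded K x ->
  positive ((K%:C)%C *: 1 - x).
Proof.
move=> K0 xx xK v; rewrite actB linearBl /= actZ linearZl_LR /= act1 subr_ge0.
have xr : inner (act x v) v \is Num.real.
  by apply/CrealP; rewrite -innerC -act_star xx.
apply: le_trans (real_ler_norm xr) _.
rewrite -(@ler_pXn2r _ 2) ?nnegrE ?normr_ge0 ?mulr_ge0 ?dnorm_ge0 ?ler0c //.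
apply: le_trans (cauchy_schwarz _ _) _.
rewrite -exprMn ler_pXn2r ?nnegrE ?mulr_ge0 ?normr_ge0 ?dnorm_ge0 ?ler0c //.
by rewrite (inner_norm v) expr2 mulrA ler_wpM2r.
Qed.

(** Provides the scalings that reduce self-adjoint elements to contractions. *)
Lemma selfadjoint_bound x : star x = x ->
  exists2 K : R, 0 < K & positive ((K%:C)%C *: 1 - x) /\ positive ((K%:C)%C *: 1 + x).
Proof.
move=> xx; have [K xK] := op_bounded_ex x.
have K1 : 0 < `|K| + 1 by rewrite ltr_wpDl.
have {}xK : op_bounded (`|K| + 1) x.
  by apply: op_boundedW xK; rewrite (le_trans (ler_norm K)) // lerDl.
exists (`|K| + 1) => //; split; first by apply: op_bounded_le_cst => //; exact: ltW.
rewrite -[x in X in positive X]opprK; apply: op_bounded_le_cst; first exact: ltW.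
  by rewrite starN xx.
by move=> v; rewrite actN normrN.
Qed.

Lemma starZr (k : R) x : star ((k%:C)%C *: x) = (k%:C)%C *: star x.
Proof. by rewrite starZ; congr (_ *: _); apply/eqP; rewrite eq_complex /= oppr0 !eqxx. Qed.

Lemma scaleCA (k l : R) x : (k%:C)%C *: ((l%:C)%C *: x) = (((k * l)%:C)%C *: x).
Proof. by rewrite scalerA -rmorphM. Qed.

Lemma positiveZr (k : R) x : 0 <= k -> positive x -> positive ((k%:C)%C *: x).
Proof. by move=> k0; apply: positiveZ; rewrite ler0c. Qed.

Lemma scale_contraction x : positive x -> exists2 k : R, 0 < k &
  contraction (((k^-1)%:C)%C *: x) /\ x = (k%:C)%C *: (((k^-1)%:C)%C *: x).
Proof.
move=> x0; have [k k0 [k1 _]] := selfadjoint_bound (positive_star x0).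
have kE y : (k%:C)%C *: (((k^-1)%:C)%C *: y) = y.
  by rewrite scaleCA divff ?gt_eqF // scale1r.
have kV : 0 <= k^-1 by rewrite invr_ge0 ltW.
exists k => //; split=> //; split; first exact: positiveZr.
have -> : 1 - ((k^-1)%:C)%C *: x = ((k^-1)%:C)%C *: ((k%:C)%C *: 1 - x).
  by rewrite scalerBr scaleCA mulVf ?gt_eqF // scale1r.
exact: positiveZr.
Qed.

(** Commuting [a] and [b] give [a b = s b s] with [s] the square root of [a]. *)
Lemma positive_comm a b : positive a -> positive b -> a * b = b * a -> positive (a * b).
Proof.
move=> a0 b0 ab; have [k k0 [kc ->]] := scale_contraction a0.
set a' := _ *: a; have [s [[s0 _] ss sc _]] := sqrt_contraction kc.
rewrite -scalerAl; apply: positiveZr; first exact: ltW.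
rewrite /a' -ss -mulrA -(sc b); last by rewrite -scalerAr -scalerAl ab.
by rewrite mulrA; apply: positive_sandwich => //; exact: positive_star.
Qed.

End FunctionalCalculus.

(** * Spectral projections *)

Section SpectralProjections.
Context {R : realType} {H : hilbertType R} {M : tracialVonNeumannType H}.
Implicit Types (x y a b c h p r s t z : M) (u v w : H).

Definition projection p := star p = p /\ p * p = p.

Lemma projection0 : projection 0. Proof. by rewrite /projection star0 mul0r. Qed.

Lemma projection1 : projection 1. Proof. by rewrite /projection star1 mul1r. Qed.

Lemma projectionC p : projection p -> projection (1 - p).
Proof.
move=> [ps pp]; split; first by rewrite starB star1 ps.
have -> : (1 - p) * (1 - p) = 1 - p - (p - p * p) by ncring.
by rewrite pp subrr subr0.
Qed.

Lemma projection_positive p : projection p -> positive p.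
Proof. by move=> [ps <-]; exact: positive_sqr. Qed.

Lemma projection_contraction p : projection p -> contraction p.
Proof.
by move=> pp; split; [|have := projectionC pp]; exact: projection_positive.
Qed.

(** The iterates for the square root of [h ^ 2] never exceed [1 - h]. If
    [z <= 1 - h], then the next iterate differs from [1 - h] by half of
    [(1 - h) ^ 2 - z ^ 2], a product of commuting positive elements. *)
Lemma sqrt_iter_le h n : star h = h -> positive (1 - h) -> positive (1 + h) ->
  positive (1 - sqrt_iter (1 - h * h) n - h).
Proof.
move=> hh h1 hN; have a0 : positive (1 - h * h).
  have -> : 1 - h * h = (1 - h) * (1 + h) by ncring.
  by apply: positive_comm => //; ncring.
elim: n => [|n IH]; first by rewrite /= subr0.
have ha : h * (1 - h * h) = (1 - h * h) * h by ncring.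
have := sqrt_iter_comm n ha; have [z0 _] := sqrt_iter_mono n a0.
rewrite /=; move: IH z0; set z := sqrt_iter _ n => IH z0 hz.
rewrite -[1 - _ - h]addrAC.
have -> : 1 - h - (2^-1 : R[i]) *: (1 - h * h + z * z) =
    (2^-1 : R[i]) *: ((1 - z - h) * (1 - h + z)).
  rewrite -{1}[1 - h]halfD -scalerBr; congr (_ *: _).
  have -> : (1 - z - h) * (1 - h + z) =
    (1 - h + (1 - h)) - (1 - h * h + z * z) + (z * h - h * z) by ncring.
  by rewrite hz subrr addr0.
apply: positiveZ; first exact: half_ge0.
apply: positive_comm => //; first exact: positiveD.
have -> : (1 - z - h) * (1 - h + z) = (1 - h + z) * (1 - z - h) + (z * h - h * z) + (z * h - h * z).
  by ncring.
by rewrite hz subrr !addr0.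
Qed.

(** The absolute value [t] of [h]. Its order properties come from those of the
    iterates. *)
Lemma abs_contraction h : star h = h -> positive (1 - h) -> positive (1 + h) ->
  exists t, [/\ contraction t, t * t = h * h,
    forall b, b * h = h * b -> b * t = t * b, positive (t - h) & positive (t + h)].
Proof.
move=> hh h1 hN; have [|t [tc tt tb tl]] := @sqrt_contraction _ _ _ (h * h).
  split; first exact: positive_sqr.
  have -> : 1 - h * h = (1 - h) * (1 + h) by ncring.
  by apply: positive_comm => //; ncring.
exists t; split => //.
- by move=> b bh; apply: tb; rewrite mulrA bh -!mulrA bh.
- apply: strong_cvg_positive (fun n => sqrt_iter_le n hh h1 hN).
  by apply: strong_cvgB tl _; exact: strong_cvg_cst.
- have hNN : positive (1 + - h) by [].
  have hNN' : positive (1 - - h) by rewrite opprK.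
  have hs : star (- h) = - h by rewrite starN hh.
  have := fun n => sqrt_iter_le n hs hNN' hNN; rewrite mulrNN opprK => P.
  by apply: strong_cvg_positive P; apply: strong_cvgD tl _; exact: strong_cvg_cst.
Qed.

(** The iterated square roots of [x] increase, and their limit is idempotent as
    [x n.+1 ^ 2 = x n]. *)
Lemma support x : contraction x -> exists p, [/\ projection p, p * x = x,
  forall b, x * b = 0 -> p * b = 0 & forall b, b * x = x * b -> b * p = p * b].
Proof.
move=> xc.
pose P x y := contraction x -> [/\ contraction y, y * y = x &
  forall b, b * x = x * b -> b * y = y * b].
have [f fP] : {f : M -> M & forall x, P x (f x)}.
  apply: choice => y; have [yc|yc] := EM (contraction y); last by exists 0.
  by have [s [s1 s2 s3 _]] := sqrt_contraction yc; exists s.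
pose y n := iter n f x.
have yc n : contraction (y n) by elim: n => // n /fP[].
have yS n : y n.+1 * y n.+1 = y n by have [] := fP _ (yc n).
have [||n|p [yp py p1 p0 _]] := @monotone_limit _ _ _ y.
- by move=> n; have [] := yc n.
- by move=> n; rewrite -[X in _ - X]yS; apply: positive_sub_sqr; have [] := yc n.+1.
- by have [] := yc n.
have ps := positive_star p0.
have pp : p * p = p.
  apply: (@strong_cvg_unique _ _ _ (fun n => y n.+1 * y n.+1)).
    apply: (@strong_cvgM _ _ _ 1) => // [n||]; try exact: strong_cvgS.
    by apply: op_bounded_contraction; have [] := yc n.+1.
  by under eq_fun do rewrite yS.
have xp : x * (1 - p) = 0.
  have [s [[s0 _] ss _ _]] := sqrt_contraction xc.
  suff sp : s * (1 - p) = 0 by rewrite -ss -mulrA sp mulr0.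
  apply: starM_eq0; rewrite starM starB star1 ps (positive_star s0).
  have E : (1 - p) * s * (s * (1 - p)) = (1 - p) * x * (1 - p) by rewrite -ss !mulrA.
  have p1s : star (1 - p) = 1 - p by rewrite starB star1 ps.
  rewrite E; apply: positive_antisym.
    by apply: positive_sandwich => //; have [] := xc.
  have := positive_sandwich p1s (py 0); rewrite /y /=.
  have -> : (1 - p) * (p - x) * (1 - p) = - ((1 - p) * x * (1 - p)) +
    (p - p * p) - (p - p * p) * p by ncring.
  by rewrite pp subrr mul0r subr0 addr0.
exists p; split => //.
- have : star (x * (1 - p)) = 0 by rewrite xp star0.
  rewrite starM starB star1 ps (contraction_star xc) mulrBl mul1r => /eqP.
  by rewrite subr_eq0 => /eqP.
- move=> b xb; apply: (@strong_cvg_unique _ _ _ (fun n => y n * b)).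
    exact: strong_cvgMr.
  suff yb n : y n * b = 0 by under eq_fun do rewrite yb; exact: strong_cvg_cst.
  elim: n => // n IH; apply: starM_eq0.
  by rewrite starM (contraction_star (yc _)) -mulrA [y n.+1 * (_ * _)]mulrA yS IH mulr0.
- move=> b bx; have by_ n : b * y n = y n * b.
    by elim: n => // n IH; have [_ _] := fP _ (yc n); apply.
  apply: (strong_cvg_unique (strong_cvgMl (b := b) yp)).
  by under eq_fun do rewrite by_; exact: strong_cvgMr.
Qed.

(** The support projection of the positive part of [h] separates it from the
    negative part, as the two have product zero. *)
Lemma spectral_cut h : star h = h -> exists p, [/\ projection p,
  forall b, b * h = h * b -> b * p = p * b,
  positive (p * h) & positive ((1 - p) * - h)].
Proof.
move=> hh; have [k k0 [k1 kN]] := selfadjoint_bound hh.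
have kV : 0 <= k^-1 by rewrite invr_ge0 ltW.
have kE y : ((k^-1)%:C)%C *: ((k%:C)%C *: y) = y.
  by rewrite scaleCA mulVf ?gt_eqF // scale1r.
pose g := ((k^-1)%:C)%C *: h.
have gs : star g = g by rewrite starZr hh.
have g1 : positive (1 - g).
  by have := positiveZr kV k1; rewrite scalerBr kE.
have gN : positive (1 + g).
  by have := positiveZr kV kN; rewrite scalerDr kE.
have [t [tc tt tb tm tp]] := abs_contraction gs g1 gN.
have gt : g * t = t * g by exact: tb.
pose u := (2^-1 : R[i]) *: (t + g); pose w := (2^-1 : R[i]) *: (t - g).
have uc : contraction u.
  split; first by apply: positiveZ => //; exact: half_ge0.
  rewrite -[1 in X in positive X]halfD -scalerBr; apply: positiveZ; first exact: half_ge0.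
  have -> : 1 + 1 - (t + g) = (1 - t) + (1 - g) by ncring.
  by apply: positiveD => //; have [] := tc.
have uw : u * w = 0.
  rewrite /u /w -scalerAl -scalerAr.
  have -> : (t + g) * (t - g) = (t * t - g * g) + (g * t - t * g) by ncring.
  by rewrite tt gt !subrr addr0 !scaler0.
have guw : g = u - w.
  rewrite /u /w -scalerBr -[LHS]halfD; congr (_ *: _); by ncring.
have [p [pp pu pw pb]] := support uc.
have hE : h = (k%:C)%C *: (u - w).
  by rewrite -guw /g scaleCA divff ?gt_eqF // scale1r.
have w0 : positive w by apply: positiveZ => //; exact: half_ge0.
have [u0 _] := uc.
exists p; split => //.
- move=> b bh; apply: pb; rewrite /u -scalerAl -scalerAr mulrDl mulrDr.
  have bg : b * g = g * b by rewrite /g -scalerAl -scalerAr bh.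
  by rewrite bg tb.
- rewrite hE -scalerAr mulrBr pu pw // subr0; apply: positiveZr => //; exact: ltW.
- rewrite hE -scalerN -scalerAr; apply: positiveZr; first exact: ltW.
  by rewrite opprB mulrBr !mulrBl !mul1r pu pw // subr0 subrr subr0.
Qed.

(** The geometric series for [1 - b], multiplied by [l] to stay below [1]. *)
Lemma inverse_contraction b (l : R) : 0 < l -> positive (1 - b) ->
  positive (b - (l%:C)%C *: 1) -> exists r, [/\ b * r = 1, r * b = 1, positive r &
    forall c, c * b = b * c -> c * r = r * c].
Proof.
move=> l0 b1 bl; have [a aE] : exists a, a = 1 - b by exists (1 - b).
rewrite -aE in b1 *.
pose L : M := (l%:C)%C *: 1.
have cL c : c * L = L * c by rewrite /L -scalerAl -scalerAr mulr1 mul1r.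
pose y := fix y n := if n is m.+1 then L + a * y m else 0 : M.
have yc c n : c * a = a * c -> c * y n = y n * c.
  move=> ca; elim: n => [|n IH] /=; first by rewrite mulr0 mul0r.
  by rewrite mulrDr mulrDl cL mulrA ca -!mulrA IH.
have l0' : positive L by apply: positiveZr; [exact: ltW|exact: positive1].
have y0 n : positive (y n).
  elim: n => [|n IH] /=; first exact: positive0.
  by apply: positiveD => //; apply: positive_comm => //; exact: yc.
have yS n : positive (y n.+1 - y n).
  elim: n => [|n IH]; first by rewrite /= mulr0 addr0 subr0.
  have -> : y n.+2 - y n.+1 = a * (y n.+1 - y n) by rewrite /=; ncring.
  by apply: positive_comm => //; rewrite mulrBl mulrBr !yc.
have y1 n : positive (1 - y n).
  elim: n => [|n IH]; first by rewrite /= subr0; exact: positive1.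
  have -> : 1 - y n.+1 = (b - L) + a * (1 - y n) by rewrite /= aE; ncring.
  apply: positiveD => //; apply: positive_comm => //.
  by rewrite mulrBl mulrBr yc // mulr1 mul1r.
have [s [ys _ _ s0 _]] := monotone_limit y0 yS y1.
have sE : s = L + a * s.
  apply: (strong_cvg_unique (strong_cvgS ys)).
  by apply: strong_cvgD; [exact: strong_cvg_cst|exact: strong_cvgMl].
have sc c : c * b = b * c -> c * s = s * c.
  move=> cb; apply: (strong_cvg_unique (strong_cvgMl (b := c) ys)).
  have -> : (fun n => c * y n) = (fun n => y n * c); last exact: strong_cvgMr.
  by apply/funext => n; apply: yc; rewrite aE mulrBr mulrBl cb mulr1 mul1r.
have bs : b * s = L.
  have -> : b * s = s - a * s by rewrite aE; ncring.
  by rewrite {1}sE addrK.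
have lV : ((l^-1)%:C)%C *: L = 1.
  by rewrite /L scaleCA mulVf ?gt_eqF // scale1r.
exists (((l^-1)%:C)%C *: s); split.
- by rewrite -scalerAr bs lV.
- by rewrite -scalerAl -sc // bs lV.
- by apply: positiveZr => //; rewrite invr_ge0 ltW.
- by move=> c cb; rewrite -scalerAl -scalerAr sc.
Qed.

End SpectralProjections.

(** * Polar decomposition *)

Section PolarDecomposition.
Context {R : realType} {H : hilbertType R} {M : tracialVonNeumannType H}.
Implicit Types (x y a b c d h m p r s t z v w : M).

(** Faithfulness of the trace, extended from the elements [star x * x] by means
    of square roots. *)
Lemma positive_rtr_le0 x : positive x -> rtr x <= 0 -> x = 0.
Proof.
move=> x0 xt; have [k k0 [kc xE]] := scale_contraction x0.
have [s [[s0 _] ss _ _]] := sqrt_contraction kc.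
have s00 : s = 0.
  apply/norm2_eq0/eqP; rewrite -sqrf_eq0 eq_le sqr_ge0 andbT.
  rewrite -rtr_starM (positive_star s0) ss rtrZ.
  by rewrite pmulr_rle0 ?invr_gt0.
by rewrite xE -ss s00 mulr0 scaler0.
Qed.

Lemma pisomK v : projection (star v * v) -> v * (star v * v) = v.
Proof.
move=> [_ vv]; apply/eqP; rewrite -subr_eq0; apply/eqP/starM_eq0.
rewrite starB !starM starK.
have -> : (star v * v * star v - star v) * (v * (star v * v) - v) =
   star v * v * (star v * v) * (star v * v) - star v * v * (star v * v)
   - (star v * v * (star v * v) - star v * v) by ncring.
by rewrite !vv !subrr.
Qed.

Lemma projection_pisom_star v : projection (star v * v) -> projection (v * star v).
Proof.
move=> vv; split; first by rewrite starM starK.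
by rewrite mulrA -[v * star v * v]mulrA pisomK.
Qed.

(** Polar decomposition of [a] restricted to the spectral projection [p] of
    [x = star a * a] above [l]. There [x] is invertible: [b = x p + (1 - p)] lies
    between [l] and [1], and [r] is its square root. So [a * r' * p] is a partial
    isometry with initial projection [p]. *)
Lemma polar_cut_contraction a (l : R) : contraction (star a * a) -> 0 < l -> l <= 1 ->
  exists p r r', [/\ projection p, p * (star a * a) = star a * a * p,
    positive (p * (star a * a - (l%:C)%C *: 1)),
    positive ((1 - p) * ((l%:C)%C *: 1 - star a * a)) &
    [/\ contraction r, r * r' = 1, r' * r = 1, p * r = r * p &
      r * r * p = star a * a * p /\ star (a * r' * p) * (a * r' * p) = p]].
Proof.
set x := star a * a => xc l0 l1.
have xs : star x = x by rewrite /x starM starK.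
have [L LE] : exists L : M, L = (l%:C)%C *: 1 by eexists.
have cL c : c * L = L * c by rewrite LE -scalerAl -scalerAr mulr1 mul1r.
have L0 : positive L by rewrite LE; apply: positiveZr; [exact: ltW|exact: positive1].
have L1 : positive (1 - L).
  have -> : 1 - L = ((1 - l)%:C)%C *: 1 by rewrite LE rmorphB scalerBl scale1r.
  by apply: positiveZr; [rewrite subr_ge0|exact: positive1].
have hs : star (x - L) = x - L by rewrite starB xs (positive_star L0).
have [p [pp pc p0 p1]] := spectral_cut hs.
rewrite -LE; rewrite opprB in p1; have [ps p2] := pp.
have px : p * x = x * p.
  by symmetry; apply: pc; rewrite mulrBl mulrBr cL.
have pp0 := projection_positive pp.
have pp1 := projection_positive (projectionC pp).
have [b bE] : exists b, b = x * p + (1 - p) by eexists.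
have b1 : positive (1 - b).
  have -> : 1 - b = (1 - x) * p by rewrite bE; ncring.
  apply: positive_comm => //; first by case: xc.
  by rewrite mulrBl mulrBr mulr1 mul1r px.
have bL : positive (b - L).
  have -> : b - L = p * (x - L) + (1 - p) * (1 - L) + (x * p - p * x).
    by rewrite bE; ncring.
  rewrite px subrr addr0; apply: positiveD => //; apply: positive_comm => //.
  have -> : (1 - L) * (1 - p) = (1 - p) * (1 - L) + (L * p - p * L) by ncring.
  by rewrite cL subrr addr0.
have bc : contraction b.
  split=> //; have -> : b = (b - L) + L by rewrite subrK.
  exact: positiveD.
have [r [rc rr rb _]] := sqrt_contraction bc.
have pb : p * b = b * p.
  have -> : p * b = p * x * p + (p - p * p) by rewrite bE; ncring.
  by rewrite px bE; ncring.
have pr : p * r = r * p by exact: rb.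
have rL : positive (r - L).
  have -> : r - L = (r - r * r) + (b - L) by rewrite rr; ncring.
  by apply: positiveD => //; case: rc => ? ?; exact: positive_sub_sqr.
rewrite LE in rL.
have [r' [rr' r'r r'0 r'c]] := inverse_contraction l0 rc.2 rL.
have rrp : r * r * p = x * p.
  rewrite rr; have -> : b * p = x * (p * p) + (p - p * p) by rewrite bE; ncring.
  by rewrite p2 subrr addr0.
have pr' : p * r' = r' * p by exact: r'c.
exists p, r, r'; split=> //; split=> //; split=> //.
rewrite !starM ps (positive_star r'0).
have -> : p * (r' * star a) * (a * r' * p) = p * r' * x * (r' * p) by rewrite /x !mulrA.
by rewrite -pr' mulrA -[_ * x * p]mulrA -rrp pr' !mulrA -[r' * p * r]mulrA pr mulrA r'r mul1r
  -[p * r * p]mulrA -pr mulrA p2 -[p * r * r']mulrA rr' mulr1.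
Qed.

(** The contraction hypothesis is removed by scaling; the scaling factor is taken
    large enough for the rescaled threshold not to exceed [1]. *)
Lemma polar_cut a (l : R) : 0 < l -> exists p r r', [/\ projection p,
    p * (star a * a) = star a * a * p,
    positive (p * (star a * a - (l%:C)%C *: 1)),
    positive ((1 - p) * ((l%:C)%C *: 1 - star a * a)) &
    [/\ positive r, r * r' = 1, r' * r = 1, p * r = r * p &
      r * r * p = star a * a * p /\ star (a * r' * p) * (a * r' * p) = p]].
Proof.
move=> l0; have [k0 k00 [[_ k0c] _]] := scale_contraction (positive_starM a).
pose k := k0 + l; have kp : 0 < k by rewrite addr_gt0.
have kc : contraction (((k^-1)%:C)%C *: (star a * a)).
  split; first by apply: positiveZr; [rewrite invr_ge0 ltW|exact: positive_starM].
  have c0 : 0 <= k0 / k by rewrite divr_ge0 ?ltW.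
  have c1 : 0 <= l / k by rewrite divr_ge0 ?ltW.
  have := positiveD (positiveZr c0 k0c) (positiveZr c1 positive1).
  rewrite scalerBr scaleCA mulrAC divff ?gt_eqF // mul1r addrAC -scalerDl -rmorphD /=.
  by rewrite -mulrDl divff ?gt_eqF // scale1r.
pose e := Num.sqrt k^-1; have e0 : 0 < e by rewrite sqrtr_gt0 invr_gt0.
have ee : e * e = k^-1 by rewrite -expr2 sqr_sqrtr // invr_ge0 ltW.
have eV : e^-1 * e = 1 by rewrite mulVf ?gt_eqF.
have eVV : e^-1 * e^-1 = k by rewrite -invfM ee invrK.
pose b := (e%:C)%C *: a.
have bb : star b * b = ((k^-1)%:C)%C *: (star a * a).
  by rewrite /b starZr -scalerAl -scalerAr scaleCA ee.
rewrite -bb in kc.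
have lk0 : 0 < l / k by rewrite divr_gt0.
have lk1 : l / k <= 1 by rewrite ler_pdivrMr // mul1r /k lerDr ltW.
have aa : star a * a = (k%:C)%C *: (star b * b).
  by rewrite bb scaleCA divff ?gt_eqF // scale1r.
have lE : (l%:C)%C *: 1 = (k%:C)%C *: (((l / k)%:C)%C *: 1) :> M.
  by rewrite scaleCA mulrC divfK ?gt_eqF.
have [p [r [r' [pp pb p0 p1 [[r0 _] rr' r'r pr [rrp vp]]]]]] :=
  polar_cut_contraction kc lk0 lk1.
exists p, (((e^-1)%:C)%C *: r), ((e%:C)%C *: r'); split=> //.
- by rewrite aa -scalerAr -scalerAl pb.
- by rewrite aa lE -scalerBr -scalerAr; apply: positiveZr; first exact: ltW.
- by rewrite aa lE -scalerBr -scalerAr; apply: positiveZr; first exact: ltW.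
split.
- by apply: positiveZr => //; rewrite invr_ge0 ltW.
- by rewrite -scalerAl -scalerAr scaleCA eV scale1r.
- by rewrite -scalerAl -scalerAr scaleCA mulrC eV scale1r.
- by rewrite -scalerAl -scalerAr pr.
split; first by rewrite aa -!scalerAl -scalerAr -scalerAl scaleCA eVV rrp.
by have -> : a * ((e%:C)%C *: r') * p = b * r' * p; rewrite // /b -scalerAl -scalerAr.
Qed.

(** Half the trace of [star a * a] is a threshold above which a nonzero spectral
    projection must survive. The two factorizations locate the partial isometry:
    [v = a * d] bounds its range, [star v * v = w * a] its initial space. *)
Lemma nonzero_pisom a : a != 0 -> exists v d w,
  [/\ projection (star v * v), star v * v != 0, v = a * d & star v * v = w * a].
Proof.
move=> a0; have t0 : 0 < rtr (star a * a).
  rewrite lt_neqAle rtr_ge0 ?andbT; last exact: positive_starM.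
  apply: contra a0 => /eqP t0; apply/eqP/starM_eq0/positive_rtr_le0.
    exact: positive_starM.
  by rewrite -t0.
have l0 : 0 < rtr (star a * a) / 2 by rewrite divr_gt0.
have [p [r [r' [pp pa p0 p1 [_ rr' r'r pr [rrp vp]]]]]] := polar_cut a l0.
exists (a * r' * p), (r' * p), (r' * r' * p * star a).
rewrite vp mulrA; split=> //.
- apply/eqP => p00; move: p1; rewrite p00 subr0 mul1r => /rtr_le.
  by rewrite rtrZ rtr1 mulr1; lra.
- rewrite -mulrA -[r' * r' * p * _]mulrA pa -rrp.
  by rewrite !mulrA -[r' * r' * r]mulrA r'r mulr1 r'r mul1r.
Qed.

End PolarDecomposition.

(** * A maximality principle and comparison of projections *)

(** Follow a sequence in which each step achieves at least half of the possible
    increase of [mu]. Above its upper bound nothing can increase [mu] further, since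
    otherwise every step would gain a fixed amount. *)
Lemma brezis_browder (R : realType) (T : Type) (le : T -> T -> Prop) (mu : T -> R)
    (B : R) :
  (forall s, le s s) -> (forall s t u, le s t -> le t u -> le s u) ->
  (forall s t, le s t -> mu s <= mu t) -> (forall t, mu t <= B) ->
  (forall f : nat -> T, (forall n, le (f n) (f n.+1)) ->
    exists t, forall n, le (f n) t) ->
  forall s, exists2 t, le s t & forall t', le t t' -> mu t' <= mu t.
Proof.
move=> lexx le_trans mono muB chain s.
pose above t := [set mu t' | t' in le t].
have above_sup t : has_sup (above t).
  split; first by exists (mu t), t.
  by exists B => _ [t' _ <-].
have [next nextP] : {next : T -> T & forall t, le t (next t) /\
    sup (above t) - mu t <= 2 * (mu (next t) - mu t)}.
  apply: (@choice _ _ (fun t t' => le t t' /\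
    sup (above t) - mu t <= 2 * (mu t' - mu t))) => t; have [supt|supt] := leP (sup (above t)) (mu t).
    by exists t; split=> //; rewrite subrr mulr0 subr_le0.
  have e0 : 0 < (sup (above t) - mu t) / 2 by rewrite divr_gt0 ?subr_gt0.
  have [_ [t' tt' <-] h] := sup_adherent e0 (above_sup t).
  by exists t'; split=> //; move: h; lra.
pose f n := iter n next s.
have fS n : le (f n) (f n.+1) by have [] := nextP (f n).
have [t ft] := chain f fS; exists t; first exact: ft 0.
move=> t' tt'; rewrite leNgt; apply/negP => ltt'.
pose d := (mu t' - mu t) / 2; have d0 : 0 < d by rewrite divr_gt0 ?subr_gt0.
have step n : mu (f n) + d <= mu (f n.+1).
  have [_] := nextP (f n); rewrite -/(f n.+1).
  have : mu t' <= sup (above (f n)).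
    apply: (@ub_le_sup _ (above (f n))); first by have [] := above_sup (f n).
    by exists t' => //; apply: le_trans (ft n) tt'.
  by have := mono _ _ (ft n); rewrite /d; lra.
have grow n : mu s + d *+ n <= mu (f n).
  elim: n => [|n IH]; first by rewrite mulr0n addr0.
  by rewrite mulrSr addrA; apply: Order.POrderTheory.le_trans (step n); rewrite lerD2r.
have [n] : exists n, (B - mu s) / d < n%:R.
  exists (Num.bound `|(B - mu s) / d|).
  by apply: le_lt_trans (ler_norm _) _; exact: archi_boundP.
rewrite ltr_pdivrMr // mulr_natl => h.
by have := grow n; have := muB (f n); lra.
Qed.

Section Comparison.
Context {R : realType} {H : hilbertType R} {M : tracialVonNeumannType H}.
Implicit Types (x y a b d p q z u v w e f : M).

Lemma projection_le p q : projection p -> projection q -> q * p = p -> positive (q - p).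
Proof.
move=> [ps pp] [qs qq] qp.
have pq : p * q = p by have := congr1 star qp; rewrite starM ps qs.
have -> : q - p = (1 - p) * q * (1 - p) + (p * q - p) - (p * q - p) * p +
  (q * p - p * p) by ncring.
rewrite qp pq pp !subrr mul0r subr0 !addr0.
by apply: positive_sandwich; [rewrite starB star1 ps|exact: projection_positive].
Qed.

Lemma projection_mul p q : projection p -> projection q -> positive (q - p) -> q * p = p.
Proof.
move=> pp qq qp; have [ps p2] := pp; have [_ q2] := qq; have [qs1 _] := projectionC qq.
have pq : p * (1 - q) = 0.
  apply: starM_eq0; rewrite starM qs1 ps.
  have -> : (1 - q) * p * (p * (1 - q)) = (1 - q) * p * (1 - q).
    by rewrite mulrA -[_ * p * p]mulrA p2.
  apply: positive_antisym.
    by apply: positive_sandwich => //; exact: projection_positive.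
  have := positive_sandwich qs1 qp.
  have -> : (1 - q) * (q - p) * (1 - q) =
    - ((1 - q) * p * (1 - q)) + (q - q * q) * (1 - q) by ncring.
  by rewrite q2 subrr mul0r addr0.
have := congr1 star pq; rewrite starM qs1 ps star0 mulrBl mul1r => /eqP.
by rewrite subr_eq0 => /eqP.
Qed.

Lemma projection_limit (u : nat -> M) : (forall n, projection (u n)) ->
  (forall n, positive (u n.+1 - u n)) ->
  exists p, [/\ projection p, strong_cvg u p & forall n, p * u n = u n].
Proof.
move=> up uS.
have [|n|p [cp py _ p0 _]] := @monotone_limit _ _ _ u _ uS.
- by move=> n; exact: projection_positive.
- by case: (projection_contraction (up n)).
have pp : projection p.
  split; first exact: positive_star.
  apply: (@strong_cvg_unique _ _ _ (fun n => u n * u n)).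
    apply: (@strong_cvgM _ _ _ 1) => // n.
    by apply: op_bounded_contraction; case: (projection_contraction (up n)).
  by under eq_fun do rewrite (up _).2.
by exists p; split=> // n; exact: projection_mul.
Qed.

(** The elements [y] with [x m y = 0] for all [m] form an ideal. A projection [q]
    in it of maximal trace is a left unit for it, hence central, hence a scalar. *)
Lemma factor_annihilator x z : Defs.factor M -> (forall m, x * m * z = 0) -> x = 0 \/ z = 0.
Proof.
move=> facM xz; pose Q p := projection p /\ forall m, x * m * p = 0.
have Q0 : Q 0 by split; [exact: projection0|move=> m; rewrite mulr0].
have [|s t u st tu|s t|t|u uS|[q [qq xq]] _ qmax] := @brezis_browder R {p : M | Q p}
  (fun i j => positive (sval j - sval i)) (fun i => rtr (sval i)) 1 _ _ _ _ _
  (exist _ 0 Q0).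
- by move=> s; rewrite subrr; exact: positive0.
- exact: positive_trans st tu.
- exact: rtr_le.
- by rewrite -(@rtr1 _ _ M); apply: rtr_le; case: (projection_contraction (proj2_sig t).1).
- have [|p [pp up pu]] := @projection_limit (fun n => sval (u n)) _ uS.
    by move=> n; case: (proj2_sig (u n)).
  have Qp : Q p.
    split=> // m; apply: (strong_cvg_unique (strong_cvgMl (b := x * m) up)).
    have E n : x * m * sval (u n) = 0 by case: (proj2_sig (u n)).
    by under eq_fun do rewrite E; exact: strong_cvg_cst.
  exists (exist _ p Qp) => n; apply: projection_le => //=.
  by case: (proj2_sig (u n)).
rewrite /= in qmax.
have qI y : (forall m, x * m * y = 0) -> q * y = y.
  move=> xy; apply/eqP; rewrite eq_sym -subr_eq0; apply/negPn/negP => y0.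
  have xy' m : x * m * (y - q * y) = 0.
    by rewrite mulrBr xy mulrA xq mul0r subrr.
  have : star (y - q * y) != 0.
    by apply: contra y0 => /eqP h; rewrite -[_ - _]starK h star0.
  move=> /nonzero_pisom[v [d [w [vv vv0 _ vw]]]].
  set p := star v * v in vv vv0 vw.
  have pE : p = (y - q * y) * star w by case: vv => <- _; rewrite vw starM starK.
  have qp : q * p = 0.
    have -> : q * p = (q - q * q) * y * star w by rewrite pE; ncring.
    by rewrite qq.2 subrr !mul0r.
  have pq : p * q = 0.
    by rewrite -vv.1 -qq.1 -starM qp star0.
  have Qqp : Q (q + p).
    split; last by move=> m; rewrite mulrDr xq add0r pE mulrA xy' mul0r.
    split; first by rewrite starD qq.1 vv.1.
    have -> : (q + p) * (q + p) = q * q + q * p + p * q + p * p by ncring.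
    by rewrite qq.2 vv.2 qp pq !addr0.
  have := qmax (exist _ _ Qqp); rewrite /= [q + p]addrC addrK => /(_ (projection_positive vv)).
  rewrite rtrD gerDr => /positive_rtr_le0 h.
  by rewrite h ?eqxx // in vv0; exact: projection_positive.
have qmq m : q * m * q = m * q.
  by rewrite -mulrA; apply: qI => k; rewrite mulrA -[x * k * m]mulrA xq.
have [c qc] : exists c : R[i], q = c%:A.
  apply: facM => m; rewrite -qmq; apply: (can_inj starK).
  by rewrite !starM qq.1 mulrA qmq.
have [c0|c0] := eqVneq c 0.
  by right; rewrite -(qI z xz) qc c0 scale0r mul0r.
left; have := xq 1; rewrite mulr1 qc -scalerAr mulr1 => /eqP.
by rewrite scaler_eq0 (negPf c0) => /eqP.
Qed.

Lemma op_bounded_pisom v : projection (star v * v) -> op_bounded 1 v.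
Proof.
move=> /projection_contraction[_ v1]; apply: op_bounded_starM => //.
by rewrite expr1n scale1r.
Qed.

(** The partial isometries whose initial projection lies below [e] and whose final
    projection lies below [f]. *)
Definition pisom_into e f v := [/\ projection (star v * v), f * v = v & v * e = v].

(** The first condition says that the partial isometry [w] extends [v]; the second,
    that the initial projections increase, makes transitivity immediate. *)
Definition pisom_ext v w := w * (star v * v) = v /\ star w * w * (star v * v) = star v * v.

Lemma pisom_ext_trans u v w : pisom_ext u v -> pisom_ext v w -> pisom_ext u w.
Proof.
move=> [h1 h2] [k1 k2]; split.
  by rewrite -[X in w * X]h2 [w * _]mulrA k1 h1.
by rewrite -[X in star w * w * X]h2 [star w * w * _]mulrA k2 h2.
Qed.

(** The squared norms of differences are the increments of the increasing initial
    projections, so the strong limit exists; that it is again a partial isometry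
    uses [v * P n = u n], which avoids limits of adjoints. *)
Lemma pisom_chain_limit e f (u : nat -> M) : (forall n, pisom_into e f (u n)) ->
  (forall n, pisom_ext (u n) (u n.+1)) ->
  exists2 v, pisom_into e f v & forall n, pisom_ext (u n) v.
Proof.
move=> uef uS; pose P n := star (u n) * u n.
have PP n : projection (P n) by case: (uef n).
have ext_refl n : pisom_ext (u n) (u n) by split; [exact/pisomK/PP|exact: (PP n).2].
have ext n m : (n <= m)%N -> pisom_ext (u n) (u m).
  elim: m => [|m IH]; first by rewrite leqn0 => /eqP ->.
  rewrite leq_eqVlt => /predU1P[-> //|/IH[h1 h2]].
  exact: pisom_ext_trans (conj h1 h2) (uS m).
have PS n m : (n <= m)%N -> positive (P m - P n).
  by move=> /ext[_ h]; apply: projection_le.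
have [p [pp Pp pP]] := projection_limit PP (fun n => PS n n.+1 (leqnSn n)).
have [||v n|v _ uv] := @strong_limit_ex _ _ _ u 1
   (fun xi n => complex.Re (inner (act (P n) xi) xi)) (fun xi => complex.Re (inner xi xi)).
- by move=> n; apply/op_bounded_pisom/PP.
- move=> v n m nm; rewrite -actB -form_star.
  have -> : star (u m - u n) * (u m - u n) = P m - P n.
    have [h1 h2] := ext n m nm; rewrite -/(P n) -/(P m) in h1 h2.
    have mn : star (u m) * u n = P n by rewrite -h1 mulrA h2.
    have nm' : star (u n) * u m = P n by rewrite -(PP n).1 -mn starM starK.
    have -> : star (u m - u n) * (u m - u n) =
      P m - star (u m) * u n - star (u n) * u m + P n by rewrite starB /P; ncring.
    by rewrite mn nm'; ncring.
  rewrite -[leLHS]RRe_real ?ger0_real //; last exact: PS.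
  by rewrite actB linearBl /= raddfB.
- have [_ /(_ v)] := projection_contraction (PP n).
  by rewrite actB linearBl /= act1 subr_ge0 lecE => /andP[].
have vP n : v * P n = u n.
  apply: (strong_cvg_unique (strong_cvgMr uv)).
  move=> w; apply: cvg_near_cst; exists n => // m /= nm.
  by rewrite (ext n m nm).1.
have vp : v * p = v.
  apply: (strong_cvg_unique (strong_cvgMl Pp)).
  by under eq_fun do rewrite vP.
have vv : star v * v = p.
  have E : star v * v = p * (star v * v) * p.
    have vps : p * star v = star v by have := congr1 star vp; rewrite starM pp.1.
    by rewrite mulrA vps -mulrA vp.
  rewrite E; apply: (@strong_cvg_unique _ _ _ (fun n => P n * (star v * v * P n))).
    rewrite -mulrA; apply: (@strong_cvgM _ _ _ 1) => //.
      move=> n; apply: op_bounded_contraction; by case: (projection_contraction (PP n)).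
    exact: strong_cvgMl.
  have -> // : (fun n => P n * (star v * v * P n)) = P.
  apply/funext => n; rewrite -{1}(PP n).1 mulrA [star (P n) * _]mulrA -starM vP.
  by rewrite -mulrA vP.
exists v => [|n]; last by split; [exact: vP|rewrite vv; exact: pP].
split; first by rewrite vv.
  apply: (strong_cvg_unique (strong_cvgMl uv)).
  have E n : f * u n = u n by case: (uef n).
  by under eq_fun do rewrite E.
apply: (strong_cvg_unique (strong_cvgMr uv)).
have E n : u n * e = u n by case: (uef n).
by under eq_fun do rewrite E.
Qed.

(** If a maximal partial isometry from [e] to [f] left room on both sides, the
    factor would connect the two remainders by a nonzero partial isometry, and the
    sum of the two would be a larger one. *)
Lemma comparison e f : Defs.factor M -> projection e -> projection f ->
  exists2 v, pisom_into e f v & star v * v = e \/ v * star v = f.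
Proof.
move=> facM [es ee] [fs ff].
have Q0 : pisom_into e f 0.
  by split; rewrite ?mulr0 ?mul0r //; exact: projection0.
have [|s t u st tu|s t [st1 st2]|t|u uS|[v vef] _ vmax] :=
  @brezis_browder R {v : M | pisom_into e f v}
  (fun i j => pisom_ext (sval i) (sval j))
  (fun i => rtr (star (sval i) * sval i)) 1 _ _ _ _ _ (exist _ 0 Q0).
- by move=> [s [ss _ _]] /=; split; [exact: pisomK|exact: ss.2].
- exact: pisom_ext_trans st tu.
- by apply/rtr_le/projection_le => //; [case: (proj2_sig s)|case: (proj2_sig t)].
- rewrite -(@rtr1 _ _ M); apply: rtr_le.
  have tp : projection (star (sval t) * sval t) by case: (proj2_sig t).
  by case: (projection_contraction tp).
- have [v vef uv] := @pisom_chain_limit e f (fun n => sval (u n))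
    (fun n => proj2_sig (u n)) uS.
  by exists (exist _ v vef).
rewrite /= in vmax; exists v => //; have [vv fv ve] := vef.
set p := star v * v in vv; set q := v * star v.
have qq : projection q by exact: projection_pisom_star.
have pe : p * e = p by rewrite /p -mulrA ve.
have ep : e * p = p by have := congr1 star pe; rewrite starM es vv.1.
have fq : f * q = q by rewrite /q mulrA fv.
have qf : q * f = q by have := congr1 star fq; rewrite starM fs qq.1.
have [|/eqP e0] := EM (p = e); first by left.
have [|/eqP f0] := EM (q = f); first by right.
exfalso.
have [m m0] : exists m, (f - q) * m * (e - p) != 0.
  apply: contrapT => h; have [m||] := @factor_annihilator (f - q) (e - p) facM.
  - by apply/eqP/negPn/negP => m0; apply: h; exists m.
  - by move=> /eqP; rewrite subr_eq0 eq_sym (negPf f0).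
  - by move=> /eqP; rewrite subr_eq0 eq_sym (negPf e0).
have [w [d [z [ww ww0 wd wz]]]] := nonzero_pisom m0.
have vp : v * p = v by exact: pisomK.
have fqfq : (f - q) * (f - q) = f - q.
  have -> : (f - q) * (f - q) = f * f - f * q - q * f + q * q by ncring.
  by rewrite ff fq qf qq.2; ncring.
have epep : (e - p) * (e - p) = e - p.
  have -> : (e - p) * (e - p) = e * e - e * p - p * e + p * p by ncring.
  by rewrite ee ep pe vv.2; ncring.
have wf : (f - q) * w = w by rewrite wd !mulrA fqfq.
have we : w * (e - p) = w.
  have wwe : star w * w * (e - p) = star w * w by rewrite wz -!mulrA epep.
  by rewrite -{1}(pisomK ww) -mulrA wwe pisomK.
have vfq : star v * (f - q) = 0.
  have vf : star v * f = star v by have := congr1 star fv; rewrite starM fs.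
  have pv : p * star v = star v by have := congr1 star vp; rewrite starM vv.1.
  by rewrite mulrBr vf /q mulrA -/p pv subrr.
have vw : star v * w = 0 by rewrite -wf mulrA vfq mul0r.
have wv : star w * v = 0 by have := congr1 star vw; rewrite starM starK star0.
have epp : (e - p) * p = 0 by rewrite mulrBl ep vv.2 subrr.
have wp : w * p = 0 by rewrite -we -mulrA epp mulr0.
have E : star (v + w) * (v + w) = p + star w * w.
  have -> : star (v + w) * (v + w) = p + star v * w + star w * v + star w * w.
    by rewrite starD /p; ncring.
  by rewrite vw wv !addr0.
have pw : p * (star w * w) = 0 by have := congr1 star wp; rewrite starM vv.1 star0 mulrA => ->; rewrite mul0r.
have Qvw : pisom_into e f (v + w).
  split; rewrite ?E.
  - split; first by rewrite starD vv.1 ww.1.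
    have -> : (p + star w * w) * (p + star w * w) =
      p * p + p * (star w * w) + star w * (w * p) + star w * w * (star w * w) by ncring.
    by rewrite vv.2 pw wp ww.2 mulr0 !addr0.
  - by rewrite mulrDr fv -{1}wf mulrA mulrBr ff fq wf.
  - by rewrite mulrDl ve -{1}we -mulrA mulrBl ee pe we.
have /(vmax (exist _ _ Qvw)) : pisom_ext v (v + w).
  split; first by rewrite -/p mulrDl vp wp addr0.
  by rewrite E -/p mulrDl vv.2 -mulrA wp mulr0 addr0.
rewrite /= E -/p rtrD gerDl => /positive_rtr_le0 h.
by rewrite h ?eqxx // in ww0; exact: projection_positive.
Qed.

End Comparison.

(** * Uniqueness of the trace *)

Section TraceUniqueness.
Context {R : realType} {H : hilbertType R} {M : tracialVonNeumannType H}.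
Implicit Types (x y a b c d p q z u v w e f : M).

(** In whichever direction comparison works, the projection left over has trace
    zero. *)
Lemma pisom_equal_trace p q : Defs.factor M -> projection p -> projection q ->
  rtr p = rtr q -> exists2 v, star v * v = p & v * star v = q.
Proof.
move=> facM pp qq pqt; have [v [vv fv ve] h] := comparison facM pp qq.
have vv' := projection_pisom_star vv.
have E1 : positive (p - star v * v).
  apply: projection_le => //; have := congr1 star ve; rewrite starM pp.1 => E.
  by rewrite mulrA E.
have E2 : positive (q - v * star v) by apply: projection_le => //; rewrite mulrA fv.
exists v; apply/eqP; rewrite eq_sym -subr_eq0; apply/eqP/positive_rtr_le0 => //.
- rewrite rtrB pqt; case: h => [->|<-]; first by rewrite pqt subrr.
  by rewrite rtr_mulC subrr.
- rewrite rtrB -pqt; case: h => [<-|->]; last by rewrite pqt subrr.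
  by rewrite rtr_mulC subrr.
Qed.

(** Greedy: as long as [p] is equivalent to a subprojection of [e], remove that
    subprojection, which lowers the trace of [e] by that of [p]. *)
Lemma pisom_cover p n e : Defs.factor M -> projection p -> projection e ->
  rtr e <= rtr p *+ n ->
  exists2 l : seq M, (forall c, c \in l -> p * c = c) & \sum_(c <- l) star c * c = e.
Proof.
move=> facM pp; elim: n e => [|n IH] e ee en.
  exists [::] => //; rewrite big_nil; apply/esym/positive_rtr_le0 => //.
  exact: projection_positive.
have [v [vv pv ve] [<-|h]] := comparison facM ee pp.
  exists [:: v]; last by rewrite big_seq1.
  by move=> c; rewrite inE => /eqP ->.
have ev : e * (star v * v) = star v * v.
  by have := congr1 star ve; rewrite starM ee.1 mulrA => ->.
have ve' : star v * v * e = star v * v by rewrite -mulrA ve.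
have e'p : projection (e - star v * v).
  split; first by rewrite starB ee.1 vv.1.
  have -> : (e - star v * v) * (e - star v * v) =
    e * e - e * (star v * v) - star v * v * e + star v * v * (star v * v) by ncring.
  by rewrite ee.2 ev ve' vv.2 subrK.
have [|l lp le] := IH _ e'p.
  by rewrite rtrB rtr_mulC h lerBlDr -mulrSr.
exists (v :: l); last by rewrite big_cons le addrC subrK.
by move=> c; rewrite inE => /predU1P[->|/lp].
Qed.

Section TracialState.
Variable phi : M -> R[i].
Hypothesis phi_scalar : scalar phi.
Hypothesis phi1 : phi 1 = 1.
Hypothesis phi_mulC : forall x y, phi (x * y) = phi (y * x).
Hypothesis phi_ge0 : forall x, 0 <= phi (star x * x).

Let phiD x y : phi (x + y) = phi x + phi y.
Proof. by rewrite -[x in LHS]scale1r phi_scalar mul1r. Qed.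

Let phi0 : phi 0 = 0.
Proof. by have/eqP := phiD 0 0; rewrite addr0 -subr_eq subrr eq_sym => /eqP. Qed.

Let phiZ k x : phi (k *: x) = k * phi x.
Proof. by rewrite -[k *: x]addr0 phi_scalar phi0 addr0. Qed.

Let phiN x : phi (- x) = - phi x.
Proof. by rewrite -scaleN1r phiZ mulN1r. Qed.

Let rphi x : R := complex.Re (phi x).

Let rphiB x y : rphi (x - y) = rphi x - rphi y.
Proof. by rewrite /rphi phiD phiN raddfB. Qed.

Let rphiZ (k : R) x : rphi ((k%:C)%C *: x) = k * rphi x.
Proof. by rewrite /rphi phiZ; case: (phi x) => ? ? /=; rewrite mul0r subr0. Qed.

Let phi_positive x : positive x -> 0 <= phi x.
Proof.
move=> x0; have [k k0 [kc ->]] := scale_contraction x0.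
have [s [[s0 _] <- _ _]] := sqrt_contraction kc.
rewrite phiZ mulr_ge0 //; first by rewrite ler0c ltW.
by rewrite -{1}(positive_star s0).
Qed.

Let rphi_ge0 x : positive x -> 0 <= rphi x.
Proof. by move=> /phi_positive; rewrite lecE => /andP[]. Qed.

Section Excess.
Variable C : R.
Hypothesis C1 : 1 < C.

Let D x : R := rphi x - C * rtr x.

Let DB x y : D (x - y) = D x - D y.
Proof. by rewrite /D rphiB rtrB; ring. Qed.

Let D0 : D 0 = 0. Proof. by rewrite /D /rphi phi0 /rtr tr0 /=; ring. Qed.

Let DD x y : D (x + y) = D x + D y.
Proof. by rewrite -[y in LHS]opprK DB -[- y]add0r DB D0; ring. Qed.

Let DZ (k : R) x : D ((k%:C)%C *: x) = k * D x.
Proof. by rewrite /D rphiZ rtrZ; ring. Qed.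

(** Exhaustion by elements on which [phi >= C * tr]. The inequality passes to the
    limit [s] of an increasing sequence [y] although [phi] need not be normal:
    [phi (s - y n) >= phi (y m - y n)], while [tr (y m)] tends to [tr s]. *)
Let excess_maximal : exists2 t : M, contraction t & 0 <= D t /\
  forall x, positive x -> positive (1 - t - x) -> 0 <= D x -> x = 0.
Proof.
have c0 : contraction (0 : M).
  by split; [exact: positive0|rewrite subr0; exact: positive1].
have [|i j k ij jk|i j [ij _]|i|y yS|[t ct] [/= _ t0] tmax] :=
  @brezis_browder R {t : M | contraction t}
  (fun i j => positive (sval j - sval i) /\ 0 <= D (sval j - sval i))
  (fun i => rtr (sval i)) 1 _ _ _ _ _ (exist _ 0 c0).
- by move=> i; rewrite subrr D0; split=> //; exact: positive0.
- case: ij jk => [ij1 ij2] [jk1 jk2]; split; first exact: positive_trans ij1 jk1.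
  have -> : sval k - sval i = (sval j - sval i) + (sval k - sval j) by ncring.
  by rewrite DD addr_ge0.
- exact: rtr_le.
- by rewrite -(@rtr1 _ _ M); apply: rtr_le; case: (proj2_sig i).
- have y0 n : positive (sval (y n)) by case: (proj2_sig (y n)).
  have yS1 n : positive (sval (y n.+1) - sval (y n)) by case: (yS n).
  have y1 n : positive (1 - sval (y n)) by case: (proj2_sig (y n)).
  have [s [ys sy s1 s0 slub]] := monotone_limit y0 yS1 y1.
  exists (exist _ s (conj s0 s1)) => n /=; split=> //.
  have Dy m : (n <= m)%N -> 0 <= D (sval (y m) - sval (y n)).
    elim: m => [|m IH]; first by rewrite leqn0 => /eqP ->; rewrite subrr D0.
    rewrite leq_eqVlt => /predU1P[->|/IH h]; first by rewrite subrr D0.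
    have -> : sval (y m.+1) - sval (y n) =
      (sval (y m.+1) - sval (y m)) + (sval (y m) - sval (y n)) by ncring.
    by rewrite DD addr_ge0 //; case: (yS m).
  apply/ler_addgt0Pr => r r0; have C0 : 0 < C by apply: lt_trans C1.
  have [m] := rtr_monotone_limit y0 yS1 slub (divr_gt0 r0 C0).
  rewrite ltrBlDr => hm.
  have {}hm : rtr s < rtr (sval (y (maxn n m))) + r / C.
    apply: lt_le_trans hm _; rewrite lerD2r; apply: rtr_le.
    exact/(positive_mono yS1)/leq_maxr.
  have := Dy _ (leq_maxl n m); rewrite !DB.
  have := rphi_ge0 (sy (maxn n m)); rewrite rphiB.
  move: hm; rewrite -(ltr_pM2l C0) mulrDr [C * (r / C)]mulrC divfK ?gt_eqF //.
  by rewrite /D; lra.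
rewrite /= subr0 in t0; exists t => //; split=> // x x0 xt Dx.
have ctx : contraction (t + x).
  split; first by apply: positiveD => //; case: ct.
  by have -> : 1 - (t + x) = 1 - t - x by ncring.
have := tmax (exist _ _ ctx); rewrite /= [t + x]addrC addrK => /(_ (conj x0 Dx)).
by rewrite rtrD gerDr; exact: positive_rtr_le0.
Qed.

(** Here [z = 1 - t] dominates no positive element of positive excess. If
    [v = z * d] is a partial isometry, then [q = v * star v] is at most a multiple of
    [z], and so is [y * star y] whenever [q * y = y]. *)
Let dominated_projection : Defs.factor M -> exists2 q : M, projection q /\ q != 0 &
  forall y, q * y = y -> D (y * star y) <= 0.
Proof.
move=> facM; have [t [t0 t1] [Dt tmax]] := excess_maximal.
have [z zE] : exists z, z = 1 - t by eexists.
have z0 : positive z by rewrite zE.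
have z1 : positive (1 - z) by rewrite zE opprB addrC subrK.
have Dz x : positive x -> positive (z - x) -> D x <= 0.
  move=> x0 xz; rewrite leNgt; apply/negP => Dx.
  have x00 : x = 0 by apply: tmax => //; [rewrite -zE|exact: ltW].
  by rewrite x00 D0 ltxx in Dx.
have {}Dz (k : R) x : 0 < k -> positive x -> positive ((k%:C)%C *: z - x) -> D x <= 0.
  move=> k0 x0 xz; have kV : 0 <= k^-1 by rewrite invr_ge0 ltW.
  have := Dz _ (positiveZr kV x0); rewrite DZ.
  have := positiveZr kV xz; rewrite scalerBr scaleCA mulVf ?gt_eqF // scale1r.
  by move=> /[swap] /[apply]; rewrite pmulr_rle0 // invr_gt0.
have zn0 : z != 0.
  apply/eqP => z00; have tE : t = 1 by apply/esym/eqP; rewrite -subr_eq0 -zE z00.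
  by move: Dt; rewrite tE /D rtr1 /rphi phi1 /= mulr1 subr_ge0 leNgt C1.
have [v [d [_ [vv vv0 vd _]]]] := nonzero_pisom zn0.
have qq := projection_pisom_star vv; set q := v * star v in qq.
have [k k0 [dk _]] := selfadjoint_bound (positive_star (positive_starM (star d))).
have qz : positive ((k%:C)%C *: z - q).
  have -> : q = z * (star (star d) * star d) * z.
    by rewrite /q vd starM starK (positive_star z0) !mulrA.
  have := positiveD (positiveZr (ltW k0) (positive_sub_sqr z0 z1))
    (positive_sandwich (positive_star z0) dk).
  have [L LE] : exists L : M, L = (k%:C)%C *: 1 by eexists.
  rewrite scalerBr -LE.
  have -> : (k%:C)%C *: (z * z) = z * L * z by rewrite LE -scalerAr -scalerAl mulr1.
  have -> // : (k%:C)%C *: z - z * L * z + z * (L - star (star d) * star d) * z =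
    (k%:C)%C *: z - z * (star (star d) * star d) * z by ncring.
exists q.
  split=> //; apply: contra vv0 => /eqP q0.
  have : star v = 0 by apply: starM_eq0; rewrite starK.
  by move=> ->; rewrite mul0r.
move=> y qy; have [k' k'0 [yk _]] := selfadjoint_bound (positive_star (positive_starM (star y))).
rewrite starK in yk.
apply: (Dz (k' * k)) => //; first exact: mulr_gt0.
  by rewrite -{1}[y]starK; exact: positive_starM.
have := positiveD (positiveZr (ltW k'0) qz) (positive_sandwich qq.1 yk).
rewrite scalerBr scaleCA.
have [L LE] : exists L : M, L = (k'%:C)%C *: 1 by eexists.
have -> : (k'%:C)%C *: q = q * L * q by rewrite LE -scalerAr -scalerAl mulr1 qq.2.
rewrite -LE; have yq : star y * q = star y by have := congr1 star qy; rewrite starM qq.1.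
have -> : q * (L - y * star y) * q = q * L * q - (q * y) * (star y * q) by ncring.
rewrite qy yq.
by have -> : (((k' * k)%:C)%C *: z - q * L * q) + (q * L * q - y * star y) =
  ((k' * k)%:C)%C *: z - y * star y by ncring.
Qed.

(** With [1] the sum of the [star c * c], traciality turns [phi (star x * x)] into
    the sum of the values of [phi] at [(c * x) * star (c * x)], which [q] dominates. *)
Lemma rphi_le : Defs.factor M -> forall x, rphi (star x * x) <= C * rtr (star x * x).
Proof.
move=> facM x; have [q [qq q0] Dq] := dominated_projection facM.
have qt : 0 < rtr q.
  rewrite ltNge; apply: contra q0 => /positive_rtr_le0 ->//.
  exact: projection_positive.
have [l lq l1] : exists2 l : seq M, (forall c, c \in l -> q * c = c) &
    \sum_(c <- l) star c * c = 1.
  apply: (@pisom_cover q (Num.bound (rtr q)^-1)) => //; first exact: projection1.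
  rewrite rtr1 -mulr_natl -ler_pdivrMr // div1r ltW //.
  by apply: archi_boundP; rewrite invr_ge0 ltW.
rewrite -subr_le0 -/(D _).
have -> : star x * x = \sum_(c <- l) star x * (star c * c) * x.
  by rewrite -mulr_suml -mulr_sumr l1 mulr1.
have Dsum : D (\sum_(c <- l) star x * (star c * c) * x) =
    \sum_(c <- l) D (star x * (star c * c) * x).
  by apply: (big_morph D) => //; exact: DD.
rewrite Dsum big_seq; apply: sumr_le0 => c /lq qc.
have -> : star x * (star c * c) * x = star (c * x) * (c * x) by rewrite starM !mulrA.
have -> : D (star (c * x) * (c * x)) = D (c * x * star (c * x)).
  by rewrite /D /rphi phi_mulC rtr_mulC.
by apply: Dq; rewrite mulrA qc.
Qed.

End Excess.

(** The inequality [phi <= tr] applied to [x] and to [1 - x] gives equality on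
    positive contractions; polarization extends it to all elements. *)
Theorem tracial_state_unique : Defs.factor M -> forall x, phi x = tr x.
Proof.
move=> facM.
have le1 x : rphi (star x * x) <= rtr (star x * x).
  apply/ler_addgt0Pr => e e0; set t := rtr _.
  have t0 : 0 <= t by apply/rtr_ge0/positive_starM.
  have t1 : 0 < t + 1 by rewrite ltr_wpDl.
  have C1 : 1 < 1 + e / (t + 1) by rewrite ltrDl divr_gt0.
  apply: le_trans (rphi_le C1 facM x) _; rewrite -/t mulrDl mul1r lerD2l.
  by rewrite -mulrA ger_pMr // mulrC ler_pdivrMr // mul1r lerDl.
have le2 x : positive x -> rphi x <= rtr x.
  move=> x0; have [k k0 [kc ->]] := scale_contraction x0.
  have [s [[s0 _] <- _ _]] := sqrt_contraction kc.
  rewrite rphiZ rtrZ; apply: ler_wpM2l; first exact: ltW.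
  by have := le1 s; rewrite (positive_star s0).
have eq_pos x : positive x -> phi x = tr x.
  move=> x0; have [k k0 [[k1 k2] ->]] := scale_contraction x0.
  set y := _ *: x in k1 k2 *; rewrite phiZ trZ; congr (_ * _).
  have := le2 _ k1; have := le2 _ k2; rewrite rphiB rtrB rtr1 /rphi phi1 /rtr /=.
  have := phi_positive k1; have := @tr_positive R H M _ k1.
  case: (phi y) (tr y) => [a b] [c d]; rewrite !lecE /= => /andP[/eqP -> _] /andP[/eqP -> _] h1 h2.
  by apply/eqP; rewrite eq_complex /= eqxx andbT; apply/eqP; lra.
move=> x; pose E y := phi y - tr y.
have ED y z : E (y + z) = E y + E z by rewrite /E phiD trD; ring.
have EZ k y : E (k *: y) = k * E y by rewrite /E phiZ trZ; ring.
have E0 y : E (star y * y) = 0 by rewrite /E eq_pos ?subrr //; exact: positive_starM.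
have E1 y : E y + E (star y) = 0.
  have := E0 (1 + y); rewrite starD star1.
  have -> : (1 + star y) * (1 + y) = star 1 * 1 + star y * y + (y + star y).
    by rewrite star1; ncring.
  by rewrite !ED !E0 !add0r.
have := E1 ('i *: x); rewrite starZ !EZ conjCi mulNr => /eqP.
rewrite subr_eq0 => /eqP /(mulfI (neq0Ci _)) xs.
have := E1 x; rewrite -xs -mulr2n => /eqP; rewrite mulrn_eq0 /= subr_eq0.
by move=> /eqP.
Qed.

End TracialState.
End TraceUniqueness.

(** * Approximation by unitaries *)

Section UnitaryApproximation.
Context {R : realType} {H : hilbertType R} {M : tracialVonNeumannType H}.
Implicit Types (x y a b c d p q u v w e f : M).

Lemma pisom_add_unitary v w : projection (star v * v) ->
  star w * w = 1 - star v * v -> w * star w = 1 - v * star v -> unitary (v + w).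
Proof.
move=> vv ww1 ww2; have wp : projection (star w * w) by rewrite ww1; exact: projectionC.
have vp := pisomK vv.
have vw : star v * w = 0.
  rewrite -(pisomK wp) [w * _]mulrA ww2.
  have -> : star v * ((1 - v * star v) * w) = (star v - star v * v * star v) * w by ncring.
  have -> : star v * v * star v = star v.
    by have := congr1 star vp; rewrite starM vv.1.
  by rewrite subrr mul0r.
have wv : star w * v = 0 by have := congr1 star vw; rewrite starM starK star0.
have vws : v * star w = 0.
  have ws : star w * w * star w = star w.
    by have := congr1 star (pisomK wp); rewrite starM wp.1.
  rewrite -ws ww1.
  have -> : v * ((1 - star v * v) * star w) = (v - v * (star v * v)) * star w by ncring.
  by rewrite vp subrr mul0r.
have wvs : w * star v = 0 by have := congr1 star vws; rewrite starM starK star0.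
split.
  have -> : star (v + w) * (v + w) = star v * v + star v * w + star w * v + star w * w.
    by rewrite starD; ncring.
  by rewrite vw wv !addr0 ww1 addrC subrK.
have -> : (v + w) * star (v + w) = v * star v + v * star w + w * star v + w * star w.
  by rewrite starD; ncring.
by rewrite vws wvs !addr0 ww2 addrC subrK.
Qed.

Lemma norm2_sqrB x y : norm2 (x - y) ^+ 2 <= 2 * (norm2 x ^+ 2 + norm2 y ^+ 2).
Proof. by have := norm2_sqrD x (- y); rewrite norm2N. Qed.

(** With [y = star a * a - 1], the squared distance of [a] to [v + w] is at most
    twice that of [a p] to [v] plus [5] times the trace of [1 - p]. The first of
    these is bounded by the part of the squared norm of [y] over [p], the second
    by [16/9] times the part over [1 - p], where [star a * a <= 1/4]; and
    [5 * 16/9 < 9]. *)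
Lemma unitary_approx a : Defs.factor M -> exists2 u : M, unitary u &
  norm2 (a - u) ^+ 2 <= 9 * norm2 (star a * a - 1) ^+ 2.
Proof.
move=> facM; have l0 : 0 < 4^-1 :> R by rewrite invr_gt0.
have [p [r [r' [pp pa p0 p1 [r0 rr' r'r pr [rrp vp]]]]]] := polar_cut a l0.
set x := star a * a in pa p0 p1 rrp *; set v := a * r' * p in vp.
have vv : projection (star v * v) by rewrite vp.
have [w ww1 ww2] : exists2 w, star w * w = 1 - p & w * star w = 1 - v * star v.
  apply: pisom_equal_trace => //; first exact: projectionC.
    exact/projectionC/projection_pisom_star.
  by rewrite !rtrB [rtr (v * _)]rtr_mulC vp.
exists (v + w); first by apply: pisom_add_unitary; rewrite ?vp.
have xs : star x = x by rewrite /x starM starK.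
have rs := positive_star r0.
have [L LE] : exists L : M, L = (4^-1%:C)%C *: 1 by eexists.
have cL c : c * L = L * c by rewrite LE -scalerAl -scalerAr mulr1 mul1r.
have Ls : star L = L by rewrite LE starZr star1.
rewrite -LE in p0 p1; have [ps p2] := pp.
set y := x - 1; have ys : star y = y by rewrite /y starB xs star1.
have yp : p * y = y * p by rewrite /y mulrBr mulrBl pa mulr1 mul1r.
(* On the range of [p], with [r] the absolute value of [a], the difference
   [r - 1] is at most [r ^ 2 - 1] in absolute value, since [r + 1 >= 1]. *)
have vr : v * r = a * p.
  by rewrite /v -!mulrA pr [r' * (r * p)]mulrA r'r mul1r.
have vp' : v * p = v by rewrite /v -mulrA p2.
have N1 : norm2 (a * p - v) ^+ 2 <= rtr (p * y * (p * y)).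
  have -> : a * p - v = v * (r - 1) by rewrite mulrBr vr mulr1.
  rewrite -rtr_starM starM starB star1 rs.
  have -> : (r - 1) * star v * (v * (r - 1)) = (r - 1) * p * (r - 1).
    by rewrite -vp !mulrA.
  apply: rtr_le.
  have s0 : positive ((r - 1) * p * (r - 1)).
    by apply: positive_sandwich; [rewrite starB star1 rs|exact: projection_positive].
  have -> : p * y * (p * y) - (r - 1) * p * (r - 1) =
     (r - 1) * p * (r - 1) * (r * r + (r + r)).
    have -> : p * y * (p * y) = (r * r - 1) * (r * r - 1) * p.
      have yE : y * p = (r * r - 1) * p by rewrite /y !mulrBl rrp.
      have E : (r * r - 1) * p = p * (r * r - 1).
        by rewrite mulrBl mulrBr mul1r mulr1 mulrA pr -!mulrA pr.
      rewrite yp yE; move: (r * r - 1) E => k kp.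
      by rewrite mulrA -[k * p * k]mulrA -kp mulrA -[_ * p * p]mulrA p2.
    have E2 : p * (r - 1) = (r - 1) * p by rewrite mulrBl mulrBr pr mulr1 mul1r.
    rewrite -[(r - 1) * p * (r - 1)]mulrA E2.
    have -> : (r - 1) * ((r - 1) * p) * (r * r + (r + r)) =
      (r - 1) * (r - 1) * (p * r * r + (p * r + p * r)) by ncring.
    by rewrite !pr -[r * p * r]mulrA pr; ncring.
  apply: positive_comm => //.
    apply: positiveD; first exact: positive_sqr.
    exact: positiveD.
  have c (z : M) : z * r = r * z -> z * (r * r + (r + r)) = (r * r + (r + r)) * z.
    by move=> zr; rewrite !mulrDr !mulrDl mulrA zr -!mulrA zr.
  apply: c.
  have -> : (r - 1) * p * (r - 1) * r = (r - 1) * (p * r) * (r - 1) by ncring.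
  by rewrite pr; ncring.
(* Over [1 - p] one has [1 - x >= 3/4], hence [(1 - x) ^ 2 >= 9/16]; the remainder
   [g] is positive. *)
have N2 : 9 / 16 * rtr (1 - p) + rtr (p * y * (p * y)) <= norm2 y ^+ 2.
  rewrite -rtr_starM ys; set g := (1 - p) * (L - x) in p1.
  have gs : star g = g := positive_star p1.
  have rL z : rtr (L * z) = 4^-1 * rtr z by rewrite LE -scalerAl mul1r rtrZ.
  have gE : (1 - p) * y = L * (1 - p) - (1 - p) - g.
    by rewrite /g /y -[L * _]cL; ncring.
  have E : y * y = p * y * (p * y) + (1 - p) * y * ((1 - p) * y).
    have -> : p * y * (p * y) + (1 - p) * y * ((1 - p) * y) =
      y * y + (p * (y * p) * y + p * (y * p) * y - p * y * y - (y * p) * y) by ncring.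
    by rewrite -yp [p * (p * y)]mulrA p2; ncring.
  have pg : (1 - p) * g = g.
    by rewrite /g mulrA (projectionC pp).2.
  have gp : g * (1 - p) = g.
    by have := congr1 star pg; rewrite starM gs (projectionC pp).1.
  have q2 := (projectionC pp).2.
  have E3 : (1 - p) * y * ((1 - p) * y) = L * (L * (1 - p)) - L * (1 - p) - L * (1 - p) + (1 - p)
     - L * g - L * g + g + g + g * g.
    rewrite gE; move: (1 - p) q2 pg gp => q q2 qg gq.
    have -> : (L * q - q - g) * (L * q - q - g) =
     L * (q * L) * q - L * (q * q) - L * (q * g) - (q * L) * q + q * q + q * g
      - (g * L) * q + g * q + g * g by ncring.
    rewrite !cL q2 qg.
    have -> : L * (L * q) * q = L * (L * (q * q)) by ncring.
    have -> : L * q * q = L * (q * q) by ncring.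
    have -> : L * g * q = L * (g * q) by ncring.
    by rewrite q2 gq; ncring.
  rewrite E rtrD E3 !(rtrD, rtrN) !rL.
  have := rtr_ge0 (positive_sqr gs); have := rtr_ge0 p1.
  have := rtr_ge0 (projection_positive (projectionC pp)).
  by rewrite rtrD rtrN; lra.
have N3 : norm2 (a * (1 - p)) ^+ 2 <= 4^-1 * rtr (1 - p).
  have [q1 q2] := projectionC pp.
  rewrite -rtr_starM starM q1 rtr_mulC.
  have -> : a * (1 - p) * ((1 - p) * star a) = a * ((1 - p) * (1 - p)) * star a by ncring.
  rewrite q2 rtr_mulC mulrA -/x.
  have := rtr_ge0 p1.
  have -> : (1 - p) * (L - x) = L * (1 - p) - x * (1 - p) + (p * x - x * p).
    by rewrite -[L * _]cL; ncring.
  rewrite pa subrr addr0 rtrB LE -scalerAl mul1r rtrZ.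
  by rewrite subr_ge0.
have N4 : norm2 w ^+ 2 = rtr (1 - p) by rewrite -rtr_starM ww1.
have -> : a - (v + w) = (a * p - v) + (a * (1 - p) - w) by ncring.
have := norm2_sqrD (a * p - v) (a * (1 - p) - w).
have := norm2_sqrB (a * (1 - p)) w.
rewrite N4; move: N1 N2 N3 (rtr_ge0 (projection_positive (projectionC pp))).
have := sqr_ge0 (norm2 (a * p - v)).
move: (norm2 _ ^+ 2) (norm2 _ ^+ 2) (norm2 _ ^+ 2) (norm2 _ ^+ 2) (norm2 _ ^+ 2) => A1 A2 A3 A4 A5.
by lra.
Qed.

End UnitaryApproximation.

(** * Lifting unitaries from the ultrapower *)

Section FreeUltrafilters.
Variable U : free_ultrafilter.

Lemma ultra_cofinite N : ultra_sets U [set n | (N <= n)%N].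
Proof.
elim: N => [|N IH]; first by apply: filterS filterT.
have UN : ultra_sets U (~` [set N]) by have [/ultra_free|] := in_ultra_setVsetC [set N] (ultra_isultra U).
apply: filterS (filterI IH UN) => n [/= Nn /eqP nN].
by rewrite ltn_neqAle eq_sym nN.
Qed.

End FreeUltrafilters.

Lemma free_ultrafilter_ex : inhabited free_ultrafilter.
Proof.
have [G [GU ooG]] := ultraFilterLemma (eventually_filter).
constructor; apply: (@FreeUltrafilter G GU) => n Gn.
have Gn' : G [set m | (n < m)%N] by apply: ooG; exists n.+1.
have : G set0 by apply: filterS (filterI Gn Gn') => m [/= ->]; rewrite ltnn.
exact: filter_not_empty.
Qed.

Section UltrapowerLifting.
Context {R : realType} {H : hilbertType R} {M : tracialVonNeumannType H}.
Variable U : free_ultrafilter.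
Implicit Types (x y : M) (s t : linf M).

Lemma ultra_classM s t : ultra_class U (s * t) = ultra_class U s * ultra_class U t.
Proof. exact: ultra_piM. Qed.

Lemma ultra_class_star s : ultra_class U (linf_star s) = star (ultra_class U s).
Proof. exact: ultra_pi_starE. Qed.

Lemma ultra_class1 : ultra_class U (1 : linf M) = 1.
Proof. exact: ultra_pi1. Qed.

Lemma ultra_classP s t : ultra_class U s = ultra_class U t <-> null_seq U (s - t).
Proof. exact: ultra_piP. Qed.

Lemma unitary_op_bounded x : unitary x -> op_bounded 1 x.
Proof.
by move=> [xx _]; apply: op_bounded_starM; rewrite // expr1n scale1r xx subrr; exact: positive0.
Qed.

Lemma diagonal_embeddingP : embedding (diagonal_embedding U : M -> ultrapower M U).
Proof.
have E x y (f : linf M) : (forall n, linf_const x n = f n) -> linf_const x = f.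
  by move=> h; apply/val_inj/funext.
split; last first.
  move=> x; rewrite -[RHS](climit_cst U).
  by rewrite [LHS]pi_ultra_tr.
split.
- move=> k x y; rewrite /diagonal_embedding.
  have -> : linf_const (k *: x + y) = k *: linf_const x + linf_const y by exact/val_inj/funext.
  by rewrite /ultra_class ultra_piD ultra_piZ.
- by rewrite -ultra_class1; congr ultra_class; exact/val_inj/funext.
- by move=> x y; rewrite /diagonal_embedding -ultra_classM; congr ultra_class; exact/val_inj/funext.
- by move=> x; rewrite /diagonal_embedding -ultra_class_star; congr ultra_class; exact/val_inj/funext.
Qed.

(** The estimate of [unitary_approx] is uniform in [n], so it turns a null sequence
    [star a * a - 1] into a null sequence [a - w]. *)
Lemma unitary_lift (u : ultrapower M U) : Defs.factor M -> unitary u ->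
  exists2 w : linf M, forall n, unitary (w n) & ultra_class U w = u.
Proof.
move=> facM [uu _]; pose a := repr u; have au : ultra_class U a = u by exact: reprK.
have a1 : null_seq U (linf_star a * a - 1).
  by apply/ultra_classP; rewrite ultra_classM ultra_class_star au ultra_class1.
have [w wP] : {w : nat -> M & forall n, unitary (w n) /\
    norm2 (a n - w n) ^+ 2 <= 9 * norm2 (star (a n) * a n - 1) ^+ 2}.
  apply: (@choice _ _ (fun n w => unitary w /\
    norm2 (a n - w) ^+ 2 <= 9 * norm2 (star (a n) * a n - 1) ^+ 2)) => n.
  by have [w w1 w2] := unitary_approx (a n) facM; exists w.
have wb : w \in @bounded_seqs R H M.
  by apply/asboolP; exists 1 => n; apply: unitary_op_bounded; have [] := wP n.
exists (Linf wb) => [n|]; first by have [] := wP n.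
rewrite -au; apply/esym/ultra_classP.
by apply: (@null_seq_le _ _ _ _ _ _ 9) a1 => n; have [_] := wP n.
Qed.

End UltrapowerLifting.

(** * Star-homomorphisms and the Jung properties *)

Section StarHomomorphisms.
Context {R : realType}.

Lemma norm2_embedding (A B : tracialAlgType R) (f : A -> B) x :
  embedding f -> norm2 (f x) = norm2 x.
Proof. by move=> [[_ _ fM fs] ftr]; rewrite /norm2 -fs -fM ftr. Qed.

Lemma star_homB (A B : starAlgType R) (f : A -> B) x y :
  star_hom f -> f (x - y) = f x - f y.
Proof.
move=> [flin _ _ _]; have := flin (-1) y x.
by rewrite !scaleN1r => h; rewrite addrC h addrC.
Qed.

Lemma embedding_comp (A B C : tracialAlgType R) (f : A -> B) (g : B -> C) :
  embedding f -> embedding g -> embedding (g \o f).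
Proof.
move=> [[fl f1 fM fs] ft] [[gl g1 gM gs] gt]; split; last by move=> x /=; rewrite gt ft.
split=> [k x y|//=|x y|x] /=; first by rewrite fl gl.
- by rewrite f1 g1.
- by rewrite fM gM.
- by rewrite fs gs.
Qed.

Lemma star_hom_conj (A : starAlgType R) (u : A) : unitary u ->
  star_hom (fun x => star u * x * u).
Proof.
move=> [uu uu']; split=> [k x y||x y|x].
- by rewrite mulrDr mulrDl -scalerAr -scalerAl.
- by rewrite mulr1 uu.
- by rewrite !mulrA -[star u * x * u * star u]mulrA uu' mulr1.
- by rewrite !starM starK mulrA.
Qed.

Lemma norm2_unitary_conj (A : tracialAlgType R) (u x : A) : unitary u ->
  norm2 (u * x * star u) = norm2 x.
Proof.
move=> [uu _]; rewrite /norm2 !starM starK.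
have -> : u * (star x * star u) * (u * x * star u) = u * (star x * (star u * u) * x * star u).
  by rewrite !mulrA.
by rewrite uu mulr1 tr_mulC -[star x * x * star u * u]mulrA uu mulr1.
Qed.

Context {H : hilbertType R} {M : tracialVonNeumannType H}.

(** [tr \o g] is a tracial state, so it is the trace. *)
Lemma star_hom_embedding (g : M -> M) : Defs.factor M -> star_hom g -> embedding g.
Proof.
move=> facM gh; split=> //; have [gl g1 gM gs] := gh.
apply: (tracial_state_unique (phi := fun x => tr (g x))) => //.
- by move=> k x y; rewrite gl tr_scalar.
- by rewrite g1 tr1.
- by move=> x y; rewrite !gM tr_mulC.
- by move=> x; rewrite gM gs tr_ge0.
Qed.

End StarHomomorphisms.

Section JungProperties.
Context {R : realType} {H : hilbertType R} {M : tracialVonNeumannType H}.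

Lemma jung_weak_jung : Defs.factor M -> jung_property M -> weak_jung_property M.
Proof.
move=> facM jung f fe F e e0; have [U] := free_ultrafilter_ex.
have [u uu ufx] := jung U _ (embedding_comp fe (diagonal_embeddingP U)).
have [w wu wE] := unitary_lift facM uu.
have near x : ultra_sets U [set n | norm2 (w n * f x * star (w n) - x) < e].
  have : null_seq U (w * linf_const (f x) * linf_star w - linf_const x).
    apply/ultra_classP; rewrite !ultra_classM ultra_class_star wE; exact: ufx.
  move=> /cvgr0Pnorm_lt/(_ e e0); apply: filterS => n /=.
  by rewrite ger0_norm // norm2_ge0.
have nearF : ultra_sets U [set n | forall x, x \in F -> norm2 (w n * f x * star (w n) - x) < e].
  elim: F => [|x F IH]; first by apply: filterS filterT.
  apply: filterS (filterI (near x) IH) => n [/= h1 h2] y.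
  by rewrite inE => /predU1P[->|/h2].
have [n hn] := filter_ex nearF.
by exists (w n).
Qed.

Lemma jung_stable : Defs.factor M -> jung_property M -> self_tracially_stable M.
Proof.
move=> facM jung U f fe; have [u uu ufx] := jung U f fe.
have [w wu wE] := unitary_lift facM uu.
exists (fun n x => star (w n) * x * w n) => [n|x]; first exact: star_hom_conj.
exists (linf_star w * linf_const x * w) => //.
rewrite !ultra_classM ultra_class_star wE -/(diagonal_embedding U x) -ufx.
by rewrite !mulrA uu.1 mul1r -mulrA uu.1 mulr1.
Qed.

(** The set of [n] beyond any [k] belongs to a free ultrafilter, so conditions
    imposed on the first [n] members of a dense sequence hold in the limit for
    each of them. As [f], the diagonal embedding and conjugation by [u] all preserve
    the 2-norm, equality on a dense set is equality. *)
Lemma stable_jung : Defs.factor M -> separable M -> weak_jung_property M ->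
  self_tracially_stable M -> jung_property M.
Proof.
move=> facM [D cD dD] weak stable U f fe.
have [g gh gf] := stable U f fe.
have [d0 Dd0 _] := dD 0 1 ltr01.
have [d dE] : exists d : nat -> M, D `<=` range d.
  have /pfcard_geP[D0|[d]] := cD; first by rewrite D0 in Dd0.
  by exists d => x /(@surj _ _ _ _ d)[n _ <-]; exists n.
have [v vP] : {v : nat -> M & forall n, unitary (v n) /\
    forall x, x \in mkseq d n.+1 -> norm2 (v n * g n x * star (v n) - x) < n.+1%:R^-1}.
  apply: (@choice _ _ (fun n v => unitary v /\
    forall x, x \in mkseq d n.+1 -> norm2 (v * g n x * star v - x) < n.+1%:R^-1)) => n.
  have [|v v1 v2] := weak (g n) (star_hom_embedding facM (gh n)) (mkseq d n.+1) n.+1%:R^-1.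
    by rewrite invr_gt0.
  by exists v.
have vb : v \in @bounded_seqs R H M.
  by apply/asboolP; exists 1 => n; apply: unitary_op_bounded; have [] := vP n.
pose w := Linf vb; pose u := ultra_class U w.
have uu : unitary u.
  have E (s : linf M) : (forall n, s n = 1) -> s = 1 by move=> h; exact/val_inj/funext.
  split; rewrite /u -ultra_class_star -ultra_classM -[RHS]ultra_class1; congr ultra_class;
    apply: E => n; by have [[]] := vP n.
have ud k : u * f (d k) * star u = diagonal_embedding U (d k).
  have [s sP ->] := gf (d k).
  rewrite -ultra_class_star -!ultra_classM; apply/ultra_classP.
  apply/cvgr0Pnorm_lt => e e0.
  have [N Ne] : exists N, N.+1%:R^-1 < e.
    exists (Num.bound e^-1); rewrite invf_plt ?posrE //.
    apply: lt_trans (archi_boundP _) _; first by rewrite invr_ge0 ltW.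
    by rewrite ltr_nat.
  apply: filterS (ultra_cofinite U (maxn k N)) => n /=; rewrite geq_max => /andP[kn Nn].
  rewrite ger0_norm ?norm2_ge0 //; have [_ /(_ (d k))] := vP n; rewrite -sP => h.
  apply: lt_trans (h _) _; first by apply/mapP; exists k; rewrite // mem_iota.
  apply: le_lt_trans Ne; rewrite lef_pV2 ?posrE // ler_nat //.
exists u => // x; apply/eqP; rewrite -subr_eq0; apply/eqP.
apply: tr_faithful; rewrite tr_starM; set t := norm2 _.
suff t0 : t ^+ 2 <= 0 by rewrite (_ : t ^+ 2 = 0) //; apply/eqP; rewrite eq_le t0 sqr_ge0.
apply/ler_addgt0Pr => e e0; rewrite add0r.
pose r := Num.sqrt (e / 4); have r0 : 0 < r by rewrite sqrtr_gt0 divr_gt0.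
have rr : r ^+ 2 = e / 4 by rewrite sqr_sqrtr // divr_ge0 // ltW.
have [_ /dE[k _ <-] xk] := dD x r r0.
have de := diagonal_embeddingP U (M := M).
have tE : t = norm2 (u * f (x - d k) * star u - diagonal_embedding U (x - d k)).
  rewrite /t (star_homB _ _ fe.1) (star_homB _ _ de.1) mulrBr mulrBl ud.
  congr norm2; rewrite opprB addrA; by rewrite addrNK.
rewrite tE; apply: le_trans (norm2_sqrD _ _) _.
rewrite norm2N norm2_unitary_conj // (norm2_embedding _ fe) (norm2_embedding _ de).
have : norm2 (x - d k) ^+ 2 <= r ^+ 2.
  by rewrite ler_pXn2r ?nnegrE ?norm2_ge0 // ltW.
by rewrite rr; lra.
Qed.

End JungProperties.

Theorem proposition6 (R : realType) (H : hilbertType R) (M : II1FactorType H) :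
  separable M ->
  (jung_property M <-> weak_jung_property M /\ self_tracially_stable M).
Proof.
have facM := @II1_factor R H M.
move=> sepM; split=> [jung|[weak stable]]; last exact: stable_jung.
by split; [exact: jung_weak_jung|exact: jung_stable].
Qed.
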